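(* There is a polynomial-time algorithm that, given any collection of $n$ rank-one real square matrices $\mathcal{A}=\{u_iv_i^T\}_{i=1}^n$ (all of the same size), outputs a minimizer of $$\min_{Q\in\mathcal{Q}_n}\ \sum_{i,j=1}^n (\pi_Q)_i\, Q_{ij}\,\log|u_i^Tv_j|.$$
   Context: A square matrix is called irreducible here if for every simultaneous permutation of its rows and columns, the resulting matrix is block-diagonal with at most one diagonal block, not counting zero diagonal blocks. $\mathcal{Q}_n$ denotes the set of irreducible Markov transition matrices on $n$ states, i.e. matrices $Q\in\mathbb{R}_{\ge 0}^{n\times n}$ that are irreducible in this sense, satisfy $Q\mathbf{1}=\mathbf{1}$ (with $\mathbf{1}$ the all-ones vector), and have a unique stationary distribution; this stationary distribution is denoted $\pi_Q$ (the probability vector with $\pi_Q^TQ=\pi_Q^T$). An exact arithmetic model is assumed (in particular the logarithms $\log|u_i^Tv_j|$ are available exactly). Logarithms are natural, with conventions $\log 0=-\infty$ and $0\cdot(-\infty)=0$. *)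

(* Defs.v *)
From HB Require Import structures.
From mathcomp Require Import all_boot all_order all_fingroup all_algebra.
From mathcomp Require Import all_classical all_reals all_analysis.

Set Implicit Arguments.
Unset Strict Implicit.
Unset Printing Implicit Defensive.

Import Order.TTheory GRing.Theory Num.Theory.

Local Open Scope ring_scope.

(** * The optimisation problem *)

(* In any block-diagonal form that a simultaneous permutation of the rows and
   columns of [Q] may take, at most one diagonal block is nonzero.  This is
   connectedness of the underlying undirected graph, not the usual
   (strong-connectivity) irreducibility of Markov chains. *)
Definition irreducible_mx (R : realType) (n : nat) (Q : 'M[R]_n) : Prop :=
  forall (s : 'S_n) (m : nat) (p : 'I_m -> nat) (B : forall i, 'M[R]_(p i))
         (e : (\sum_i p i)%N = n),
    row_perm s (col_perm s Q) = castmx (e, e) (\mxdiag_i B i) ->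
    forall i j, B i != 0 -> B j != 0 -> i = j.

Definition stationary (R : realType) (n : nat) (Q : 'M[R]_n) (p : 'cV[R]_n) :
    Prop :=
  [/\ forall i, 0 <= p i 0, \sum_i p i 0 = 1 & p^T *m Q = p^T].

Definition markov_irr (R : realType) (n : nat) (Q : 'M[R]_n) : Prop :=
  [/\ forall i j, 0 <= Q i j,
      irreducible_mx Q,
      Q *m const_mx 1 = const_mx 1 :> 'cV[R]_n
    & exists! p, stationary Q p].

(* Meaningful only if [Q] has a unique stationary distribution. *)
Definition stat_dist (R : realType) (n : nat) (Q : 'M[R]_n) : 'cV[R]_n :=
  xget 0 [set p | stationary Q p]%classic.

(* [lne 0 = -oo] and [0 * -oo = 0] hold in the library. *)
Definition objective (R : realType) (n d : nat) (u v : 'I_n -> 'cV[R]_d)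
    (Q : 'M[R]_n) : \bar R :=
  (\sum_i \sum_j (stat_dist Q i 0 * Q i j)%R%:E
                 * lne `|((u i)^T *m v j) 0 0|%R%:E)%E.

Definition minimizer (R : realType) (n d : nat) (u v : 'I_n -> 'cV[R]_d)
    (Q : 'M[R]_n) : Prop :=
  markov_irr Q /\
  forall Q', markov_irr Q' -> (objective u v Q <= objective u v Q')%E.

(** * Exact-arithmetic model of computation *)

(* A real RAM presented as a while language: a memory of natural numbers, used
   for control and indexing, and a memory of exact real numbers.  Both consist
   of arrays; a cell is designated by the name of its array, which is a literal
   of the program, and a list of computed indices.

   - Natural numbers have addition and truncated subtraction but no unit-cost
     multiplication, so their bit length is at most linear in the running time
     and the size of the input.
   - There is no rounding and no conversion from reals to naturals; the only
     real literals are natural numbers.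
   - The logarithm is a primitive.  Division and logarithm are the total
     functions of the library, with value 0 at 0 and at nonpositive reals
     respectively; guarding them by a comparison has constant cost. *)
Inductive iexpr : Type :=
| ICst of nat
| IGet of nat & seq iexpr
| IAdd of iexpr & iexpr
| ISub of iexpr & iexpr.

Inductive rexpr : Type :=
| RCst of nat
| RGet of nat & seq iexpr
| RAdd of rexpr & rexpr
| RSub of rexpr & rexpr
| RMul of rexpr & rexpr
| RDiv of rexpr & rexpr
| RLn of rexpr.

Inductive bexpr : Type :=
| BILt of iexpr & iexpr
| BRLt of rexpr & rexpr
| BNot of bexpr
| BAnd of bexpr & bexpr.

Inductive cmd : Type :=
| Skip
| ISet of nat & seq iexpr & iexpr
| RSet of nat & seq iexpr & rexpr
| Seq of cmd & cmd
| If of bexpr & cmd & cmd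
| While of bexpr & cmd.

Definition memory (T : Type) := nat -> seq nat -> T.

Definition update (T : Type) (m : memory T) (a : nat) (l : seq nat) (x : T) :
    memory T :=
  fun a' l' => if (a' == a) && (l' == l) then x else m a' l'.

Record state (R : realType) := State { imem : memory nat; rmem : memory R }.

Fixpoint ieval (m : memory nat) (e : iexpr) : nat :=
  match e with
  | ICst c => c
  | IGet a l => m a (map (ieval m) l)
  | IAdd e1 e2 => (ieval m e1 + ieval m e2)%N
  | ISub e1 e2 => (ieval m e1 - ieval m e2)%N
  end.

Fixpoint reval (R : realType) (s : state R) (e : rexpr) : R :=
  match e with
  | RCst c => c%:R
  | RGet a l => rmem s a (map (ieval (imem s)) l)
  | RAdd e1 e2 => reval s e1 + reval s e2
  | RSub e1 e2 => reval s e1 - reval s e2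
  | RMul e1 e2 => reval s e1 * reval s e2
  | RDiv e1 e2 => reval s e1 / reval s e2
  | RLn e1 => ln (reval s e1)
  end.

Fixpoint beval (R : realType) (s : state R) (b : bexpr) : bool :=
  match b with
  | BILt e1 e2 => (ieval (imem s) e1 < ieval (imem s) e2)%N
  | BRLt e1 e2 => reval s e1 < reval s e2
  | BNot b1 => ~~ beval s b1
  | BAnd b1 b2 => beval s b1 && beval s b2
  end.

(* Every operation, literal and memory access has unit cost. *)
Fixpoint icost (e : iexpr) : nat :=
  match e with
  | ICst _ => 1
  | IGet _ l => (sumn (map icost l)).+1
  | IAdd e1 e2 | ISub e1 e2 => (icost e1 + icost e2).+1
  end.

Fixpoint rcost (e : rexpr) : nat :=
  match e with
  | RCst _ => 1
  | RGet _ l => (sumn (map icost l)).+1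
  | RAdd e1 e2 | RSub e1 e2 | RMul e1 e2 | RDiv e1 e2 =>
      (rcost e1 + rcost e2).+1
  | RLn e1 => (rcost e1).+1
  end.

Fixpoint bcost (b : bexpr) : nat :=
  match b with
  | BILt e1 e2 => (icost e1 + icost e2).+1
  | BRLt e1 e2 => (rcost e1 + rcost e2).+1
  | BNot b1 => (bcost b1).+1
  | BAnd b1 b2 => (bcost b1 + bcost b2).+1
  end.

Definition iset (R : realType) (s : state R) (a : nat) (l : seq iexpr)
    (e : iexpr) : state R :=
  State (update (imem s) a (map (ieval (imem s)) l) (ieval (imem s) e))
        (rmem s).

Definition rset (R : realType) (s : state R) (a : nat) (l : seq iexpr)
    (e : rexpr) : state R :=
  State (imem s)
        (update (rmem s) a (map (ieval (imem s)) l) (reval s e)).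

(* [exec c s t s']: started in [s], [c] halts in [s'] after time [t]. *)
Inductive exec (R : realType) : cmd -> state R -> nat -> state R -> Prop :=
| ExecSkip s : exec Skip s 1 s
| ExecISet s a l e :
    exec (ISet a l e) s (sumn (map icost l) + icost e).+1 (iset s a l e)
| ExecRSet s a l e :
    exec (RSet a l e) s (sumn (map icost l) + rcost e).+1 (rset s a l e)
| ExecSeq c1 c2 s1 s2 s3 t1 t2 :
    exec c1 s1 t1 s2 -> exec c2 s2 t2 s3 -> exec (Seq c1 c2) s1 (t1 + t2) s3
| ExecIfT b c1 c2 s s' t :
    beval s b -> exec c1 s t s' -> exec (If b c1 c2) s (bcost b + t) s'
| ExecIfF b c1 c2 s s' t :
    ~~ beval s b -> exec c2 s t s' -> exec (If b c1 c2) s (bcost b + t) s'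
| ExecWhileT b c s1 s2 s3 t1 t2 :
    beval s1 b -> exec c s1 t1 s2 -> exec (While b c) s2 t2 s3 ->
    exec (While b c) s1 (bcost b + t1 + t2) s3
| ExecWhileF b c s :
    ~~ beval s b -> exec (While b c) s (bcost b) s.

Lemma exec_deterministic (R : realType) (c : cmd) (s s1 s2 : state R)
    (t1 t2 : nat) :
  exec c s t1 s1 -> exec c s t2 s2 -> t1 = t2 /\ s1 = s2.
Proof.
move=> e1; elim: e1 t2 s2 => {c s t1 s1}.
- by move=> s t2 s2 e2; inversion e2.
- by move=> s a l e t2 s2 e2; inversion e2.
- by move=> s a l e t2 s2 e2; inversion e2.
- move=> c1 c2 s1 s2 s3 t1 t2 _ IH1 _ IH2 t s e2.
  inversion e2 as [| | |? ? ? s2' ? t1' t2' h1 h2| | | |]; subst.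
  by case: (IH1 _ _ h1) => -> ?; subst; case: (IH2 _ _ h2) => -> ->.
- move=> b c1 c2 s s' t bT _ IH t2 s2 e2.
  inversion e2 as [| | | |? ? ? ? ? t' b' h|? ? ? ? ? t' b' h| |]; subst.
    by case: (IH _ _ h) => -> ->.
  by rewrite bT in b'.
- move=> b c1 c2 s s' t bF _ IH t2 s2 e2.
  inversion e2 as [| | | |? ? ? ? ? t' b' h|? ? ? ? ? t' b' h| |]; subst.
    by rewrite b' in bF.
  by case: (IH _ _ h) => -> ->.
- move=> b c s1 s2 s3 t1 t2 bT _ IH1 _ IH2 t s e2.
  inversion e2 as [| | | | | |? ? ? s2' ? t1' t2' b' h1 h2|? ? ? b']; subst.
    by case: (IH1 _ _ h1) => -> ?; subst; case: (IH2 _ _ h2) => -> ->.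
  by rewrite bT in b'.
- move=> b c s bF t2 s2 e2.
  inversion e2 as [| | | | | |? ? ? s2' ? t1' t2' b' h1 h2|? ? ? b']; subst=> //.
  by rewrite b' in bF.
Qed.

(* Integer arrays 0 and 1 hold [n] and [d] (with the empty list of indices),
   real array 0 holds the entries of the [n] matrices; all other cells are 0. *)
Definition input (R : realType) (n d : nat) (A : 'I_n -> 'M[R]_d) : state R :=
  State
    (fun a l => match a, l with
                | 0%N, [::] => n
                | 1%N, [::] => d
                | _, _ => 0%N
                end)
    (fun a l => match a, l with
                | 0%N, [:: i; j; k] =>
                    match insub i, insub j, insub k with
                    | Some i', Some j', Some k' => A i' j' k'
                    | _, _, _ => 0
                    end
                | _, _ => 0
                end).

(* Real array 1 holds the result. *)
Definition output (R : realType) (n : nat) (s : state R) : 'M[R]_n :=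
  \matrix_(i, j) rmem s 1 [:: val i; val j].

(* Main.v *)
Require Import Defs.
From HB Require Import structures.
From mathcomp Require Import all_boot all_order all_fingroup all_algebra.
From mathcomp Require Import all_classical all_reals all_analysis.
From mathcomp Require Import zify ring lra.

(** Write [w i j] for [ln |u_i^T v_j|].  For a chain [Q] with stationary
    distribution [p] the numbers [p i * Q i j] form a circulation of total mass
    one, so the objective is an average of [w] along closed walks, and no
    closed walk has a smaller mean weight than the best simple cycle.
    Conversely that value is attained by a deterministic chain which runs
    around the best cycle and sends every other state to one vertex of it
    ([cycle_chain_markov], [cycle_chain_cost]): its only stationary
    distribution is uniform on the cycle, and it is irreducible in the present
    weak sense because all states eventually reach the same vertex.  Hence the
    problem is to find a cycle of minimum mean weight in the complete digraph.

    The lower bound ([stationary_cost_ge]) does not decompose the circulation.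
    Let [minw k s v] be the least weight of a walk of [k + 1] edges from [s] to
    [v].  Averaging the recursion of [minw] against [p] shows that the mean of
    [minw k s] grows by at most the objective at each step, while closing a walk
    by the edge from [v] to [s] shows that it grows by at least the minimum
    cycle mean per step; comparing both for [k] tending to infinity gives the
    bound.

    If some [u_i^T v_j] vanishes, completeness of the digraph puts that edge
    on the cycle [i -> j -> i], which has value [-oo] and is therefore optimal
    ([two_cycle_minimizer]).

    Only the matrices [A_i = u_i v_i^T] are given, which determine [u_i] and
    [v_i] up to a scalar.  The algorithm does not factor them.  With the
    Frobenius norm, [|A_j A_i|^2 = |u_j|^2 (u_i^T v_j)^2 |v_i|^2] and
    [|A_i|^2 = |u_i|^2 |v_i|^2], so
      [ln |A_j A_i|^2 - ln |A_i|^2 = 2 w i j + ln |u_j|^2 - ln |u_i|^2].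
    The last two terms are a potential difference and cancel in every
    stationary average ([stationary_potential]); these weights thus have the
    same minimizers as [w] ([cycle_minimizer]).

    The minimum mean cycle is found by dynamic programming over [minw] with
    recorded predecessors.  Among the closed walks of at most [n] edges one
    takes a walk of least mean, with as few edges as possible.  A closed walk
    with a repeated vertex splits into two shorter ones ([cweight_split]), one
    of which has no larger mean; so the walk found is a simple cycle
    ([trace_uniq]), and its mean bounds below that of every closed walk
    ([cweight_ge]).

    Running times are kept apart from correctness.  The program is written in
    a sublanguage whose loops run [n] or [d] times and whose meaning is a total
    function on states; a polynomial cost bound then follows from the syntax
    alone ([exec_compile], [pcost_poly]). *)

Set Implicit Arguments.
Unset Strict Implicit.
Unset Printing Implicit Defensive.

Import Order.TTheory GRing.Theory Num.Theory.

Local Open Scope ring_scope.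

(** * Closed walks of least mean weight *)

Section Walks.
Variables (R : realFieldType) (T : finType) (w : T -> T -> R).
Implicit Types (x y z s v : T) (p q c : seq T) (k : nat).

(** The sequence [x :: p] lists the vertices of a walk from its end to its
    start: predecessor pointers produce walks in this order. *)
Fixpoint bwalk x p : R := if p is y :: p' then w y x + bwalk y p' else 0.

(** [c] is a closed walk, read backwards as in [bwalk]; the last edge closes
    it up. *)
Definition cweight c : R := if c is x :: p then bwalk x (rcons p x) else 0.

Lemma bwalk_cat x p q : bwalk x (p ++ q) = bwalk x p + bwalk (last x p) q.
Proof. by elim: p x => [|y p IH] x /=; rewrite ?add0r // IH addrA. Qed.

Lemma repetition c :
  ~~ uniq c -> exists a y b e, c = a ++ y :: b ++ y :: e.
Proof.
elim: c => //= x c IH; rewrite negb_and negbK => /orP[|/IH].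
  by case/splitPr=> b e; exists [::], x, b, e.
by case=> a [y] [b] [e] ->; exists (x :: a), y, b, e.
Qed.

(** Cutting a closed walk at two occurrences of a vertex leaves two closed
    walks. *)
Lemma cweight_split c :
  ~~ uniq c -> exists c1 c2,
    [/\ (0 < size c1)%N, (0 < size c2)%N, size c = (size c1 + size c2)%N
      & cweight c = cweight c1 + cweight c2].
Proof.
case/repetition=> a [y] [b] [e] ->; exists (y :: b), (a ++ y :: e).
split=> //; first by rewrite size_cat addnS.
  by rewrite !size_cat /= size_cat /= !addnS addSn addnCA.
case: a => [|x a] /=.
  by rewrite rcons_cat rcons_cons -cat_rcons bwalk_cat last_rcons.
rewrite !rcons_cat !rcons_cons rcons_cat rcons_cons -!cat_rcons !bwalk_cat.
by rewrite !last_rcons; ring.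
Qed.

Fixpoint minw k s v : R :=
  if k is k'.+1 then
    let x := [arg min_(x < s) (minw k' s x + w x v)%R]%O in
    minw k' s x + w x v
  else w s v.

Lemma minw_le k s x v : minw k.+1 s v <= minw k s x + w x v.
Proof. by rewrite /=; case: arg_minP => // i _; apply. Qed.

(** This identifies the value computed from any optimal predecessor, so
    that the tie-breaking of [arg min] does not matter. *)
Lemma minw_unique k s v y :
  (forall x, minw k s y + w y v <= minw k s x + w x v) ->
  minw k s y + w y v = minw k.+1 s v.
Proof. by move=> h; apply/eqP; rewrite eq_le minw_le andbT /= h. Qed.

Lemma minw_bwalk p z x : minw (size p) z x <= bwalk x (rcons p z).
Proof.
elim: p x => [|y p IH] x /=; first by rewrite addr0.
by apply: (le_trans (minw_le _ _ y _)); rewrite addrC lerD2l.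
Qed.

Lemma minw_attained k s v :
  exists p, size p = k /\ bwalk v (rcons p s) = minw k s v.
Proof.
elim: k v => [|k IH] v; first by exists [::]; rewrite /= addr0.
rewrite /=; set x := Order.arg_min _ _ _; have [p [<- e]] := IH x.
by exists (x :: p); rewrite /= e addrC.
Qed.

Lemma minw_cweight x p : minw (size p) x x <= cweight (x :: p).
Proof. exact: minw_bwalk. Qed.

(** Closed walks of at most [#|T|] edges suffice: a longer one repeats a vertex
    and splits into shorter ones. *)
Lemma cweight_ge mu :
  (forall k s, (k < #|T|)%N -> k.+1%:R * mu <= minw k s s) ->
  forall c, (size c)%:R * mu <= cweight c.
Proof.
move=> h c; have [m] := ubnP (size c); elim: m c => // m IH c.
rewrite ltnS => ltm; have [Uc|/cweight_split] := boolP (uniq c).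
  case: c Uc {ltm} => [|x p] Uc; first by rewrite mul0r.
  apply: le_trans (minw_cweight x p); apply: h.
  by have := max_card (mem (x :: p)); rewrite (card_uniqP Uc).
case=> c1 [c2] [s1 s2 sE ->].
rewrite sE natrD mulrDl lerD // IH //.
  by apply: leq_trans ltm; rewrite sE -addn1 leq_add2l.
by apply: leq_trans ltm; rewrite sE -add1n leq_add2r.
Qed.

Lemma minw_ge mu :
  (forall k s, (k < #|T|)%N -> k.+1%:R * mu <= minw k s s) ->
  forall k s, k.+1%:R * mu <= minw k s s.
Proof.
move=> h k s; have [p [<- <-]] := minw_attained k s s.
exact: cweight_ge h (s :: p).
Qed.

(** The walk recovered from a table [pr] of predecessors. *)
Fixpoint trace (pr : nat -> T -> T -> T) k s v : seq T :=
  if k is k'.+1 then pr k s v :: trace pr k' s (pr k s v) else [::].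

Lemma size_trace pr k s v : size (trace pr k s v) = k.
Proof. by elim: k v => //= k IH v; rewrite IH. Qed.

Lemma nth_trace pr k s v t : (t < k)%N ->
  nth s (v :: trace pr k s v) t.+1
  = pr (k - t)%N s (nth s (v :: trace pr k s v) t).
Proof.
elim: k v t => // k IH v [|t] ltk; first by rewrite subn0.
by rewrite subSS; apply: (IH (pr k.+1 s v)).
Qed.

Lemma bwalk_trace pr k s v :
  (forall j x, (j < k)%N ->
     minw j s (pr j.+1 s x) + w (pr j.+1 s x) x = minw j.+1 s x) ->
  bwalk v (rcons (trace pr k s v) s) = minw k s v.
Proof.
elim: k v => [|k IH] v h; first exact: addr0.
rewrite -h // addrC /= IH // => j x ltjk; apply: h; exact: ltnW.
Qed.

(** If a closed walk of least mean repeated a vertex, it would split into two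
    shorter closed walks, both of strictly larger mean, and so would have
    larger mean than itself. *)
Lemma trace_uniq pr k s :
  let c := s :: trace pr k s s in
  cweight c = minw k s s ->
  (forall j x, (j < k)%N ->
     minw k s s / k.+1%:R < minw j x x / j.+1%:R) ->
  uniq c.
Proof.
move=> c cE h; apply/negPn/negP => /cweight_split[c1 [c2 [s1 s2 sE]]].
apply/eqP; rewrite lt_eqF // cE.
have szc : size c = k.+1 by rewrite /= size_trace.
have gt a : (0 < size a)%N -> (size a < k.+1)%N ->
    (size a)%:R * (minw k s s / k.+1%:R) < cweight a.
  case: a => //= x p _ ltk; apply: lt_le_trans (minw_cweight x p).
  by rewrite mulrC -ltr_pdivlMr ?ltr0n // h.
have kE : minw k s s = k.+1%:R * (minw k s s / k.+1%:R).
  by rewrite mulrC divfK // pnatr_eq0.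
rewrite [X in X < _]kE; set mu := _ / _ in gt *.
rewrite -szc sE natrD mulrDl.
by apply: ltrD; apply: gt => //; rewrite -szc sE; lia.
Qed.

(** Entry [i] of [rcons p x] is entry [i + 1] of the cycle [x :: p]; this way
    of indexing covers the wrap-around at [i = size p]. *)
Lemma prev_nth_uniq r x p i : uniq (x :: p) -> (i <= size p)%N ->
  prev (x :: p) (nth r (rcons p x) i) = nth r (x :: p) i.
Proof.
move=> Uc lei; have mem_i : nth r (rcons p x) i \in x :: p.
  by rewrite -mem_rcons mem_nth // size_rcons ltnS.
rewrite prev_nth mem_i (_ : index _ p = i); last first.
  move: Uc => /= /andP[xp Up].
  rewrite nth_rcons; case: (ltngtP i (size p)) lei => // [lt_i|->] _.
    by rewrite index_uniq.
  by apply/eqP; rewrite eqn_leq index_size leqNgt index_mem.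
by apply: set_nth_default; rewrite /= ltnS.
Qed.

Lemma cweight_prev c : uniq c -> cweight c = \sum_(x <- c) w x (prev c x).
Proof.
case: c => [|x p] Uc; first by rewrite big_nil.
rewrite (perm_big (rcons p x)); last by rewrite -cats1 -cat1s perm_catC.
rewrite (big_nth x) size_rcons.
transitivity (\sum_(0 <= i < (size p).+1)
    w (nth x (rcons p x) i) (nth x (x :: p) i)).
  suff h d y z : bwalk z (rcons p y) =
      \sum_(0 <= i < (size p).+1) w (nth d (rcons p y) i) (nth d (z :: p) i).
    exact: h.
  elim: p z {Uc} => [|z' p IH] z /=; first by rewrite big_nat1 addr0.
  by rewrite IH [RHS]big_nat_recl.
by apply: eq_big_nat => i /andP[_ lei]; rewrite prev_nth_uniq.
Qed.

End Walks.

(** * Markov chains *)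

Lemma natmul_bounded_le0 (R : realType) (a D : R) :
  (forall k : nat, k%:R * a <= D) -> a <= 0.
Proof.
move=> h; rewrite leNgt; apply/negP => a0.
have [k ltk] : exists k : nat, `|D| / a < k%:R.
  exists (Num.bound (`|D| / a)); apply: archi_boundP.
  by rewrite divr_ge0 // ltW.
move: (h k); rewrite leNgt -ltr_pdivrMr // => /negP; apply.
by apply: le_lt_trans ltk; rewrite ler_pM2r ?invr_gt0 // ler_norm.
Qed.

Lemma stationaryE (R : realType) n (Q : 'M[R]_n) p : stationary Q p ->
  forall j, p j 0 = \sum_i p i 0 * Q i j.
Proof.
case=> _ _ /matrixP h j; have := h 0 j; rewrite !mxE => <-.
by apply: eq_bigr => i _; rewrite mxE.
Qed.

Lemma row_sum1 (R : realType) n (Q : 'M[R]_n) :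
  Q *m const_mx 1 = const_mx 1 :> 'cV[R]_n -> forall i, \sum_j Q i j = 1.
Proof.
move=> /matrixP h i; have := h i 0; rewrite !mxE => <-.
by apply: eq_bigr => j _; rewrite mxE mulr1.
Qed.

(** With [V k] the [p]-average of [minw w k s], the recursion gives
    [V (k + 1) <= obj + V k], hence [V k <= k * obj + V 0].  Closing a walk
    from [s] to [v] by the edge [v -> s] gives [V k >= (k + 2) * mu - C].
    Both hold for all [k], so [mu <= obj]. *)
Lemma stationary_cost_ge (R : realType) n (w : 'I_n -> 'I_n -> R)
    (Q : 'M[R]_n) p mu :
  (forall i j, 0 <= Q i j) ->
  Q *m const_mx 1 = const_mx 1 :> 'cV[R]_n ->
  stationary Q p ->
  (forall k s, k.+1%:R * mu <= minw w k s s) ->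
  mu <= \sum_i \sum_j p i 0 * Q i j * w i j.
Proof.
move=> Q0 /row_sum1 Q1 stp hmu; set obj := \sum_i _.
have pE := stationaryE stp; case: stp => p0 p1 _.
have n0 : (0 < n)%N.
  case: posnP p1 => // n0; rewrite big1 => [/esym/eqP|i _].
    by rewrite oner_eq0.
  by have := ltn_ord i; rewrite [X in (_ < X)%N]n0.
pose s := Ordinal n0.
pose V k := \sum_v p v 0 * minw w k s v.
have Vstep k : V k.+1 <= obj + V k.
  have -> : obj + V k = \sum_i \sum_j p i 0 * Q i j * (minw w k s i + w i j).
    rewrite /obj /V -big_split; apply: eq_bigr => i _ /=.
    rewrite -[X in _ + X]mulr1 -(Q1 i) mulr_sumr -big_split.
    by apply: eq_bigr => j _ /=; ring.
  rewrite exchange_big /=; apply: ler_sum => j _.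
  rewrite {1}pE mulr_suml; apply: ler_sum => i _.
  by apply: ler_wpM2l; [rewrite mulr_ge0|exact: minw_le].
have Vle k : V k <= k%:R * obj + V 0%N.
  elim: k => [|k IH]; first by rewrite mul0r add0r.
  by apply: le_trans (Vstep k) _; rewrite -natr1 mulrDl mul1r; lra.
pose C := \sum_v p v 0 * w v s.
have Vge k : k.+2%:R * mu - C <= V k.
  have -> : k.+2%:R * mu - C = \sum_v p v 0 * (k.+2%:R * mu - w v s).
    under [RHS]eq_bigr do rewrite mulrBr.
    by rewrite sumrB -mulr_suml p1 mul1r.
  apply: ler_sum => v _; apply: ler_wpM2l => //; rewrite lerBlDr.
  by apply: le_trans (hmu k.+1 s) _; apply: minw_le.
rewrite -subr_le0; apply: (@natmul_bounded_le0 _ _ (V 0%N + C - 2 * mu)) => k.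
have := le_trans (Vge k) (Vle k).
by rewrite -addn2 natrD mulrDl mulrBr; lra.
Qed.

Lemma unique_stat_dist (R : realType) n (Q : 'M[R]_n) p :
  stationary Q p -> (forall p', stationary Q p' -> p' = p) -> stat_dist Q = p.
Proof.
move=> h1 h2; apply/h2/(@xgetPex _ 0 [set p | stationary Q p]%classic).
by exists p.
Qed.

Lemma stat_distP (R : realType) n (Q : 'M[R]_n) :
  markov_irr Q -> stationary Q (stat_dist Q).
Proof.
case=> _ _ _ [p [h _]].
by apply: (@xgetPex _ 0 [set p | stationary Q p]%classic); exists p.
Qed.

Definition deterministic_mx (R : realType) n (f : 'I_n -> 'I_n) : 'M[R]_n :=
  \matrix_(i, j) (j == f i)%:R.

(** As cycles are read backwards, [prev c x] is the vertex after [x] in the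
    direction of the edges.  States off the cycle are sent to [r]. *)
Definition cycle_map n (c : seq 'I_n) (r x : 'I_n) : 'I_n :=
  if x \in c then prev c x else r.

Definition cycle_dist (R : realType) n (c : seq 'I_n) : 'cV[R]_n :=
  \col_i ((i \in c)%:R / (size c)%:R).

Section CycleChain.
Variables (R : realType) (n : nat) (c : seq 'I_n) (r : 'I_n).
Hypotheses (Uc : uniq c) (rc : r \in c).
Let f := cycle_map c r.
Let Q := deterministic_mx R f.
Let p0 := cycle_dist R c.

Let fc x : f x \in c.
Proof. by rewrite /f /cycle_map; case: ifP => // xc; rewrite mem_prev. Qed.

Let size_c : (size c)%:R != 0 :> R.
Proof. by rewrite pnatr_eq0; case: c rc. Qed.

(** Every state reaches [r] under the map, so that an invariant takes one
    value only. *)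
Lemma cycle_map_const (V : eqType) (b : 'I_n -> V) :
  (forall x, b (f x) = b x) -> forall x y, b x = b y.
Proof.
move=> h; suff hr x : b x = b r by move=> x y; rewrite !hr.
wlog xc : x / x \in c.
  move=> hw; have [/hw//|xc] := boolP (x \in c).
  by rewrite -h /f /cycle_map (negPf xc).
have cyc : path.cycle (fun x y => b x == b y) c.
  apply: cycle_from_prev => // y yc; rewrite -[b y]h /f /cycle_map yc eqxx //.
have tr : transitive (fun x y => b x == b y) by move=> ? ? ? /eqP-> /eqP->.
move: rc xc; have := cyc; case: (c) => //= z q pq.
have az y : y \in z :: q -> b y = b z.
  rewrite inE => /predU1P[->//|yq]; move/(order_path_min tr)/allP: pq => /(_ y).
  by rewrite mem_rcons inE yq orbT => /(_ isT) /eqP ->.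
by move=> /az -> /az ->.
Qed.

(** Each row of the chain has a nonzero entry, so a state and its successor
    lie in the same diagonal block; by [cycle_map_const] all states lie in one
    block. *)
Lemma cycle_chain_irreducible : irreducible_mx Q.
Proof.
move=> s m q B e hQ i j Bi Bj.
have QE x y : Q (s (cast_ord e x)) (s (cast_ord e y)) = (\mxdiag_i B i) x y.
  have := congr1 (fun M : 'M[R]_n => M (cast_ord e x) (cast_ord e y)) hQ.
  by rewrite castmxE !cast_ordK !mxE.
(* [b x] is the diagonal block that contains state [x]. *)
pose b x := tagnat.sig1 (cast_ord (esym e) ((s^-1)%g x)).
have bf x : b (f x) = b x.
  set x' := cast_ord (esym e) ((s^-1)%g x).
  set y' := cast_ord (esym e) ((s^-1)%g (f x)).
  have := QE x' y'; rewrite !cast_ordKV !permKV !mxE eqxx /b -/x' -/y'.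
  by case: eqP => // _ /eqP; rewrite mxE oner_eq0.
have bij k : B k != 0 -> exists x, b x = k.
  case/matrix0Pn=> x _; exists (s (cast_ord e (tagnat.Rank k x))).
  by rewrite /b permK cast_ordK tagnat.Rank1K.
have [[x <-] [y <-]] := (bij _ Bi, bij _ Bj).
exact: cycle_map_const.
Qed.

Lemma sum_cycle : \sum_x (x \in c)%:R = (size c)%:R :> R.
Proof.
rewrite -natr_sum -(card_uniqP Uc) -sum1_card [in RHS]big_mkcond.
by congr (_%:R); apply: eq_bigr => i _; case: (i \in c).
Qed.

(** The only state of the cycle that is mapped to [j] is [next c j]. *)
Lemma sum_cycle_map (g : 'I_n -> R) j : (forall i, i \notin c -> g i = 0) ->
  \sum_i g i * Q i j = if j \in c then g (next c j) else 0.
Proof.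
move=> g0; case: ifPn => jc; last first.
  rewrite big1 // => i _; rewrite mxE.
  case: eqP => [jE|_]; last by rewrite mulr0.
  by rewrite jE fc in jc.
rewrite (bigD1 (next c j)) //= mxE /f /cycle_map mem_next jc prev_next //.
rewrite eqxx mulr1 big1 ?addr0 // => i ij; rewrite mxE.
have [ic|/g0->] := boolP (i \in c); last by rewrite mul0r.
case: eqP => [jE|_]; last by rewrite mulr0.
by rewrite jE /f /cycle_map ic next_prev // eqxx in ij.
Qed.

Lemma cycle_dist_stationary : stationary Q p0.
Proof.
split=> [i||]; first by rewrite mxE divr_ge0.
  under eq_bigr do rewrite mxE.
  by rewrite -mulr_suml sum_cycle divff.
apply/matrixP => i j; rewrite [i]ord1 !mxE; under eq_bigr do rewrite mxE.
rewrite sum_cycle_map => [|k kc]; last by rewrite mxE (negPf kc) mul0r.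
by rewrite !mxE mem_next; case: (j \in c); rewrite ?mul0r.
Qed.

(** No state is mapped to a state off the cycle, so a stationary distribution
    vanishes there; hence the mass of a state of the cycle passes unchanged to
    its successor. *)
Lemma cycle_dist_unique p : stationary Q p -> p = p0.
Proof.
move=> stp; have pE := stationaryE stp; case: stp => _ p1 _.
have poff i : i \notin c -> p i 0 = 0.
  move=> ic; rewrite pE big1 // => k _; rewrite mxE.
  by case: eqP ic => [->|_]; rewrite ?fc ?mulr0.
(* The mass as a function on all states, constant along the map: states off
   the cycle are given that of their successor [r]. *)
pose b x := p (if x \in c then x else r) 0.
have bf x : b (f x) = b x.
  rewrite /b fc; case: ifPn => xc; last by rewrite /f /cycle_map (negPf xc).
  by rewrite pE sum_cycle_map // fc /f /cycle_map xc next_prev.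
have pr x : p x 0 = (x \in c)%:R * p r 0.
  case xc: (x \in c); last by rewrite mul0r poff ?xc.
  by have := cycle_map_const bf x r; rewrite /b xc rc mul1r.
have prE : p r 0 = (size c)%:R^-1.
  apply: (mulfI size_c); rewrite divff // -sum_cycle mulr_suml -[RHS]p1.
  by apply: eq_bigr => x _; rewrite -pr.
by apply/matrixP => x j; rewrite [j]ord1 pr prE mxE.
Qed.

Lemma cycle_chain_stat_dist : stat_dist Q = p0.
Proof. exact/unique_stat_dist/cycle_dist_unique/cycle_dist_stationary. Qed.

Lemma cycle_chain_markov : markov_irr Q.
Proof.
split=> [i j|||]; first by rewrite mxE ler0n.
- exact: cycle_chain_irreducible.
- apply/matrixP => i j; rewrite !mxE (bigD1 (f i)) //= !mxE eqxx mul1r.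
  by rewrite big1 ?addr0 // => k kf; rewrite !mxE (negPf kf) mul0r.
- exists p0; split; first exact: cycle_dist_stationary.
  by move=> p /cycle_dist_unique.
Qed.

Lemma cycle_chain_cost (w : 'I_n -> 'I_n -> R) :
  \sum_i \sum_j stat_dist Q i 0 * Q i j * w i j = cweight w c / (size c)%:R.
Proof.
rewrite cycle_chain_stat_dist cweight_prev // [in RHS]big_uniq // mulr_suml.
rewrite [RHS]big_mkcond; apply: eq_bigr => i _.
rewrite (bigD1 (f i)) //= big1 ?addr0 => [|j jf]; last first.
  by rewrite [Q _ _]mxE (negPf jf) mulr0 mul0r.
rewrite !mxE eqxx mulr1 /f /cycle_map; case: ifP => _; last by rewrite !mul0r.
by rewrite mul1r mulrC.
Qed.

End CycleChain.

(** * Optimal deterministic chains *)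

Section Optimality.
Variables (R : realType) (n d : nat) (u v : 'I_n -> 'cV[R]_d).

Definition dotp i j : R := ((u i)^T *m v j) 0 0.

Lemma objective_fin (Q : 'M[R]_n) : (forall i j, dotp i j != 0) ->
  objective u v Q
  = (\sum_i \sum_j stat_dist Q i 0 * Q i j * ln `|dotp i j|)%:E.
Proof.
move=> nz; rewrite /objective -sumEFin; apply: eq_bigr => i _.
rewrite -sumEFin; apply: eq_bigr => j _.
by rewrite lne_EFin ?normr_gt0 ?nz // EFinM.
Qed.

(** A stationary distribution gives [i] the same mass as source and as target
    of edges. *)
Lemma stationary_potential (Q : 'M[R]_n) p (h : 'I_n -> R) :
  Q *m const_mx 1 = const_mx 1 :> 'cV[R]_n -> stationary Q p ->
  \sum_i \sum_j p i 0 * Q i j * (h j - h i) = 0.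
Proof.
move=> /row_sum1 Q1 /stationaryE pE.
under eq_bigr => i _ do (under eq_bigr do rewrite mulrBr; rewrite sumrB).
rewrite sumrB exchange_big /= -sumrB big1 // => i _.
by rewrite -!mulr_suml -pE -mulr_sumr Q1 mulr1 subrr.
Qed.

(** The weights [w] that the program can compute differ from
    [2 * ln |dotp i j|] by a potential difference only. *)
Lemma cycle_minimizer (w : 'I_n -> 'I_n -> R) h c r :
  (forall i j, dotp i j != 0) ->
  (forall i j, w i j = 2 * ln `|dotp i j| + (h j - h i)) ->
  uniq c -> r \in c ->
  (forall k s, k.+1%:R * (cweight w c / (size c)%:R) <= minw w k s s) ->
  minimizer u v (deterministic_mx R (cycle_map c r)).
Proof.
move=> nz wE Uc rc opt; split; first exact: cycle_chain_markov.
have cost Q : markov_irr Q ->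
    \sum_i \sum_j stat_dist Q i 0 * Q i j * w i j
    = 2 * \sum_i \sum_j stat_dist Q i 0 * Q i j * ln `|dotp i j|.
  move=> mQ; have stQ := stat_distP mQ; case: mQ => _ _ Q1 _.
  rewrite -[RHS]addr0 -[X in _ + X](stationary_potential h Q1 stQ).
  rewrite mulr_sumr -big_split.
  apply: eq_bigr => i _ /=; rewrite mulr_sumr -big_split.
  by apply: eq_bigr => j _; rewrite wE /=; ring.
move=> Q mQ; rewrite !objective_fin // lee_fin -(ler_pM2l (@ltr0Sn R 1)).
rewrite -!cost ?cycle_chain_cost //; last exact: cycle_chain_markov.
have stQ := stat_distP mQ; case: mQ => Q0 _ Q1 _.
exact: stationary_cost_ge.
Qed.

Lemma two_cycle_minimizer i j : dotp i j = 0 ->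
  minimizer u v (deterministic_mx R (fun x => if x == i then j else i)).
Proof.
move=> z; pose c := if i == j then [:: i] else [:: i; j].
have Uc : uniq c.
  by rewrite /c; case: ifPn => //= ij; rewrite inE ij.
have ic : i \in c by rewrite /c; case: ifP => _; rewrite inE eqxx.
have -> : deterministic_mx R (fun x => if x == i then j else i)
          = deterministic_mx R (cycle_map c i).
  apply/matrixP => x y; rewrite !mxE /cycle_map /c.
  congr (y == _)%:R; have [<-|ij] := eqVneq i j.
    by rewrite inE /=; case: eqP => // ->; rewrite eqxx.
  rewrite !inE /=; have [->|xi] := eqVneq x i; first by rewrite (negPf ij).
  by case: eqP.
have mQ := cycle_chain_markov R Uc ic.
split=> // Q' _.
suff -> : objective u v (deterministic_mx R (cycle_map c i)) = -oo%E.
  exact: leNye.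
apply/eqP; rewrite esum_eqNy; apply/existsP; exists i.
rewrite esum_eqNy; apply/existsP; exists j.
have Q_gt0 : (0 < stat_dist (deterministic_mx R (cycle_map c i)) i 0
                  * deterministic_mx R (cycle_map c i) i j)%R.
  rewrite cycle_chain_stat_dist // !mxE ic /cycle_map ic mul1r.
  have -> : j == prev c i.
    rewrite /c; have [<-|ij] := eqVneq i j; rewrite /= ?eqxx //.
    by rewrite (negPf ij) eqxx.
  rewrite mulr1 invr_gt0 ltr0n.
  by rewrite /c; case: ifP.
by rewrite -/(dotp i j) z normr0 le0_lneNy // gt0_muleNy ?lte_fin.
Qed.

End Optimality.

(** * Programs built from bounded loops *)

Local Open Scope nat_scope.

Notation loop_arr := 2 (only parsing).

(** [PFor x b p] runs [p] for the values from [0] of loop variable [x], as many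
    times as the natural number in array [b] says; [b] is 0 or 1 in well formed
    programs, so that the bound is one of the two sizes in the input.  All loop
    variables live in a single array, which no other command may write. *)
Inductive prog : Type :=
| PISet of nat & seq iexpr & iexpr
| PRSet of nat & seq iexpr & rexpr
| PSeq of prog & prog
| PIf of bexpr & prog
| PFor of nat & nat & prog.

Notation lv x := (IGet loop_arr [:: ICst x]).

Fixpoint compile (p : prog) : cmd :=
  match p with
  | PISet a l e => ISet a l e
  | PRSet a l e => RSet a l e
  | PSeq p1 p2 => Seq (compile p1) (compile p2)
  | PIf b p1 => If b (compile p1) Skip
  | PFor x b p1 =>
      Seq (ISet loop_arr [:: ICst x] (ICst 0))
          (While (BILt (lv x) (IGet b [::]))
             (Seq (compile p1)
                  (ISet loop_arr [:: ICst x] (IAdd (lv x) (ICst 1)))))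
  end.

(** [xs] lists the loop variables of the enclosing loops. *)
Fixpoint wf (xs : seq nat) (p : prog) : bool :=
  match p with
  | PISet a _ _ => (2 < a)
  | PRSet _ _ _ => true
  | PSeq p1 p2 => wf xs p1 && wf xs p2
  | PIf _ p1 => wf xs p1
  | PFor x b p1 => [&& x \notin xs, (b < 2) & wf (x :: xs) p1]
  end.

(** The assignments to loop variables that a [PFor] makes itself are left out;
    [run_lv] accounts for them. *)
Fixpoint iwrites (p : prog) : seq nat :=
  match p with
  | PISet a _ _ => [:: a]
  | PRSet _ _ _ => [::]
  | PSeq p1 p2 => iwrites p1 ++ iwrites p2
  | PIf _ p1 | PFor _ _ p1 => iwrites p1
  end.

Fixpoint rwrites (p : prog) : seq nat :=
  match p with
  | PISet _ _ _ => [::]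
  | PRSet a _ _ => [:: a]
  | PSeq p1 p2 => rwrites p1 ++ rwrites p2
  | PIf _ p1 | PFor _ _ p1 => rwrites p1
  end.

(** In the last case 3 pays for the initialisation of the loop variable, 4 for
    the test, which is made once more than the body is run, and 10 for the test
    and the increment together. *)
Fixpoint pcost (N : nat) (p : prog) : nat :=
  match p with
  | PISet _ l e => (sumn (map icost l) + icost e).+1
  | PRSet _ l e => (sumn (map icost l) + rcost e).+1
  | PSeq p1 p2 => pcost N p1 + pcost N p2
  | PIf b p1 => bcost b + (pcost N p1).+1
  | PFor _ _ p1 => 3 + (N * (pcost N p1 + 10) + 4)
  end.

Lemma pcost_poly p : exists c k, forall N, (pcost N p <= c * N.+1 ^ k).
Proof.
elim: p => [a l e|a l e|p [c1 [k1 h1]] q [c2 [k2 h2]]|b p|x b p].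
- by exists (sumn (map icost l) + icost e).+1, 0 => N; rewrite muln1.
- by exists (sumn (map icost l) + rcost e).+1, 0 => N; rewrite muln1.
- exists (c1 + c2), (k1 + k2) => N /=; rewrite mulnDl leq_add //.
    apply: leq_trans (h1 N) _; rewrite leq_mul2l leq_pexp2l ?orbT //.
    by rewrite leq_addr.
  apply: leq_trans (h2 N) _; rewrite leq_mul2l leq_pexp2l ?orbT //.
  by rewrite leq_addl.
- case=> c [k h]; exists (bcost b + c.+1), k => N /=.
  rewrite mulnDl mulSn leq_add //.
    by rewrite leq_pmulr // expn_gt0.
  by rewrite -add1n leq_add ?expn_gt0.
- case=> c [k h]; exists (c + 17), k.+1 => N /=; rewrite expnS.
  have := h N; have : (0 < N.+1 ^ k) by rewrite expn_gt0.
  move: (pcost _ _) (_ ^ k) => y z; nia.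
Qed.

Section Runs.
Variable R : realType.
Implicit Types (s : state R) (p : prog) (xs : seq nat).

Definition set_lv s x k : state R :=
  State (update (imem s) loop_arr [:: x] k) (rmem s).

Definition incr_lv s x : state R := set_lv s x (imem s loop_arr [:: x] + 1).

Fixpoint run (p : prog) (s : state R) : state R :=
  match p with
  | PISet a l e => iset s a l e
  | PRSet a l e => rset s a l e
  | PSeq p1 p2 => run p2 (run p1 s)
  | PIf b p1 => if beval s b then run p1 s else s
  | PFor x b p1 =>
      iter (imem s b [::]) (fun s' => incr_lv (run p1 s') x) (set_lv s x 0)
  end.

Lemma update_other (T : Type) (m : memory T) a l y a' :
  a' != a -> update m a l y a' = m a'.
Proof. by move=> ne; apply/funext => l'; rewrite /update (negPf ne). Qed.

Lemma update_same (T : Type) (m : memory T) a l y l' :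
  update m a l y a l' = if l' == l then y else m a l'.
Proof. by rewrite /update eqxx. Qed.

Lemma imem_iset s a l e l' :
  imem (iset s a l e) a l'
  = if l' == map (ieval (imem s)) l then ieval (imem s) e else imem s a l'.
Proof. exact: update_same. Qed.

Lemma imem_iset_other s a l e a' :
  a' != a -> imem (iset s a l e) a' = imem s a'.
Proof. exact: update_other. Qed.

Lemma rmem_rset s a l e l' :
  rmem (rset s a l e) a l'
  = if l' == map (ieval (imem s)) l then reval s e else rmem s a l'.
Proof. exact: update_same. Qed.

Lemma rmem_rset_other s a l e a' :
  a' != a -> rmem (rset s a l e) a' = rmem s a'.
Proof. exact: update_other. Qed.

Lemma run_iframe p s a :
  a != loop_arr -> a \notin iwrites p -> imem (run p s) a = imem s a.
Proof.
move=> a2; elim: p s => //= [a' l e|p1 IH1 p2 IH2|b p IH|x b p IH] s.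
- by rewrite inE => ne; rewrite update_other.
- by rewrite mem_cat negb_or => /andP[n1 n2]; rewrite IH2 ?IH1.
- by move=> n1; case: ifP => // _; rewrite IH.
- move=> n1; elim: (imem s b [::]) => [|k IHk] /=; first exact: update_other.
  by rewrite update_other // IH.
Qed.

Lemma run_rframe p s a : a \notin rwrites p -> rmem (run p s) a = rmem s a.
Proof.
elim: p s => //= [a' l e|p1 IH1 p2 IH2|b p IH|x b p IH] s.
- by rewrite inE => ne; rewrite update_other.
- by rewrite mem_cat negb_or => /andP[n1 n2]; rewrite IH2 ?IH1.
- by move=> n1; case: ifP => // _; rewrite IH.
- by move=> n1; elim: (imem s b [::]) => [|k IHk] //=; rewrite IH.
Qed.

Lemma run_size xs p s a : wf xs p -> (a < 2) -> imem (run p s) a = imem s a.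
Proof.
move=> w lta; apply: run_iframe; first by case: a lta => [|[|[|]]].
have : all (ltn 2) (iwrites p).
  elim: p xs w => //= [? ? ? xs ->//|p1 IH1 p2 IH2 xs /andP[w1 w2]|b x p IH xs].
    by rewrite all_cat (IH1 _ w1) (IH2 _ w2).
  by case/and3P=> _ _ /IH.
by move/allP=> h; apply/negP => /h; case: a lta {h} => [|[|[|]]].
Qed.

Lemma run_lv xs p s x :
  wf xs p -> x \in xs ->
  imem (run p s) loop_arr [:: x] = imem s loop_arr [:: x].
Proof.
elim: p xs s => //= [a l e|p1 IH1 p2 IH2|b p IH|y b p IH] xs s.
- by move=> lta _; rewrite update_other //; case: a lta => [|[|[|]]].
- by case/andP=> w1 w2 xin; rewrite (IH2 _ _ w2) ?(IH1 _ _ w1).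
- by move=> w xin; case: ifP => // _; apply: IH w xin.
- case/and3P=> yx _ w xin.
  have xy : ([:: x] == [:: y]) = false.
    by apply/negP => /eqP[xy]; rewrite -xy xin in yx.
  elim: (imem s b [::]) => [|k IHk] /=; first by rewrite update_same xy.
  by rewrite update_same xy (IH _ _ w) // inE xin orbT.
Qed.

(** The cost bound only needs [N] to bound the two sizes, which no well formed
    program changes. *)
Lemma exec_compile N xs p s :
  wf xs p -> (imem s 0 [::] <= N) -> (imem s 1 [::] <= N) ->
  exists t, exec (compile p) s t (run p s) /\ (t <= pcost N p).
Proof.
elim: p xs s => [a l e|a l e|p1 IH1 p2 IH2|b p IH|x b p IH] xs s /=.
- move=> *; exists (sumn (map icost l) + icost e).+1.
  by split=> //; constructor.
- move=> *; exists (sumn (map icost l) + rcost e).+1.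
  by split=> //; constructor.
- case/andP=> w1 w2 l0 l1; have [t1 [e1 lt1]] := IH1 _ s w1 l0 l1.
  have [||t2 [e2 lt2]] := IH2 _ (run p1 s) w2.
  + by rewrite (run_size _ w1).
  + by rewrite (run_size _ w1).
  by exists (t1 + t2); split; [apply: ExecSeq e1 e2|apply: leq_add].
- move=> w l0 l1; case: ifP => bT.
    have [t [e lt]] := IH _ s w l0 l1.
    exists (bcost b + t); split; first exact: ExecIfT.
    by rewrite leq_add2l ltnW.
  exists (bcost b + 1); split; last by rewrite leq_add2l.
  by apply: ExecIfF; rewrite ?bT //; constructor.
- case/and3P=> _ ltb w l0 l1.
  set body := Seq (compile p) _; set g := fun s' => _.
  have leb s' : (imem s' 0 [::] <= N -> imem s' 1 [::] <= N ->
      imem s' b [::] <= N) by case: b ltb {body g} => [|[|[|]]].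
  suff loop m s' : (imem s' loop_arr [:: x] + m) = imem s' b [::] ->
      (imem s' 0 [::] <= N) -> (imem s' 1 [::] <= N) ->
      exists t, exec (While (BILt (lv x) (IGet b [::])) body) s' t (iter m g s')
                /\ (t <= m * (pcost N p + 10) + 4).
    have b2 : b != 2 by case: b ltb {body g loop leb} => [|[|[|]]].
    have [|||t [e lt]] := loop (imem s b [::]) (set_lv s x 0).
    + by rewrite /= update_same eqxx add0n update_other.
    + by rewrite /= update_other.
    + by rewrite /= update_other.
    exists (3 + t); split.
      exact: ExecSeq (ExecISet s loop_arr [:: ICst x] (ICst 0)) e.
    by rewrite leq_add2l (leq_trans lt) // leq_add2r leq_mul2r leb ?orbT.
  elim: m s' => [|m IHm] s' E l0' l1'.
    exists 4; split=> //; apply: ExecWhileF.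
    by rewrite /= -E addn0 ltnn.
  have [t1 [e1 lt1]] := IH _ s' w l0' l1'.
  have xe : imem (run p s') loop_arr [:: x] = imem s' loop_arr [:: x].
    by rewrite (run_lv _ w) // inE eqxx.
  have b2 a : (a < 2) -> imem (g s') a = imem s' a.
    by case: a => [|[|//]] _; rewrite /= update_other // (run_size _ w).
  have [|||t2 [e2 lt2]] := IHm (g s').
  + by rewrite (b2 b) // -E /= update_same eqxx xe addn1 addSnnS.
  + by rewrite b2.
  + by rewrite b2.
  exists (4 + (t1 + 6) + t2); rewrite iterSr; split; last first.
    by move: lt1 lt2; rewrite mulSn; lia.
  apply: ExecWhileT e2; first by rewrite /= -E -addSnnS leq_addr.
  exact: ExecSeq e1 (ExecISet _ loop_arr [:: ICst x] (IAdd (lv x) (ICst 1))).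
Qed.

(** The states agree except for the loop variables in [xs].  Loop invariants are
    required to be stable under [sim], so that they need not speak of the
    administration of the loop. *)
Definition sim xs s s' :=
  [/\ rmem s = rmem s', forall a, a != loop_arr -> imem s a = imem s' a
    & forall x, x \notin xs ->
        imem s loop_arr [:: x] = imem s' loop_arr [:: x]].

Lemma sim_set_lv s x k : sim [:: x] s (set_lv s x k).
Proof.
split=> // [a a2|y yx]; first by rewrite /= update_other.
by rewrite /= update_same eqseq_cons andbT -[y == x]mem_seq1 (negPf yx).
Qed.

Lemma for_ind xs x b p (I : nat -> state R -> Prop) s0 :
  wf xs (PFor x b p) ->
  (forall k s s', sim [:: x] s s' -> I k s -> I k s') ->
  I 0 s0 ->
  (forall k s, (k < imem s0 b [::]) -> imem s loop_arr [:: x] = k ->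
     (forall a, (a < 2) -> imem s a = imem s0 a) ->
     I k s -> I k.+1 (run p s)) ->
  I (imem s0 b [::]) (run (PFor x b p) s0).
Proof.
case/and3P=> _ ltb w hsim h0 hS /=; set g := fun s' => _; set N := imem s0 b _.
suff h k : (k <= N) -> let s := iter k g (set_lv s0 x 0) in
    [/\ imem s loop_arr [:: x] = k, (forall a, (a < 2) -> imem s a = imem s0 a)
      & I k s] by case: (h N (leqnn N)).
elim: k => [|k IH] lek.
  split; first by rewrite /= update_same eqxx.
    by case=> [|[|//]] _; rewrite /= update_other.
  by apply: hsim h0; apply: sim_set_lv.
have [xE lowE Ik] := IH (ltnW lek); set s := iter k g _ in xE lowE Ik *.
have xe : imem (run p s) loop_arr [:: x] = k.
  by rewrite (run_lv _ w) // inE eqxx.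
split; first by rewrite /= -/s update_same eqxx xe addn1.
  move=> a lta; rewrite /= -/s update_other ?(run_size _ w) ?lowE //.
  by case: a lta => [|[|[|]]].
by rewrite /= -/s; apply: hsim (sim_set_lv _ _ _) _; apply: hS.
Qed.

Definition fors (xbs : seq (nat * nat)) p :=
  foldr (fun xb q => PFor xb.1 xb.2 q) p xbs.

(** All index tuples bounded by [Ns], in the order in which nested loops visit
    them. *)
Fixpoint grid (Ns : seq nat) : seq (seq nat) :=
  if Ns is N :: Ns' then
    flatten [seq [seq j :: t | t <- grid Ns'] | j <- iota 0 N]
  else [:: [::]].

Lemma mem_grid Ns t : (t \in grid Ns) = all2 ltn t Ns.
Proof.
elim: Ns t => [|N Ns IH] [|j t] //=.
  by apply/flatten_mapP => -[k _ /mapP[]].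
apply/flatten_mapP/andP => [[k]|[ltj tin]].
  by rewrite mem_iota => /andP[_ ltk] /mapP[u uin [-> ->]]; rewrite -IH.
by exists j; rewrite ?mem_iota // map_f // IH.
Qed.

Lemma wf_fors_disjoint xs xbs p x :
  wf xs (fors xbs p) -> x \in xs -> x \notin [seq xb.1 | xb <- xbs].
Proof.
elim: xbs xs => [|[y b] xbs IH] xs //= /and3P[yx _ w] xin.
rewrite inE negb_or (IH _ w) ?inE ?xin ?orbT // andbT.
by apply: contraNneq yx => <-.
Qed.

Lemma wf_fors_body xs xbs p :
  wf xs (fors xbs p) -> exists2 xs', wf xs' p & {subset xs <= xs'}.
Proof.
elim: xbs xs => [|[y b] xbs IH] xs /=; first by exists xs.
case/and3P=> _ _ /IH[xs' w sub]; exists xs' => // x xin.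
by apply: sub; rewrite inE xin orbT.
Qed.

(** One invariant for a whole nest of loops, indexed by the list of index
    tuples visited so far. *)
Lemma fors_ind xs xbs p (I : seq (seq nat) -> state R -> Prop) s0 :
  let Ns := [seq imem s0 xb.2 [::] | xb <- xbs] in
  wf xs (fors xbs p) ->
  (forall visited s s',
     sim [seq xb.1 | xb <- xbs] s s' -> I visited s -> I visited s') ->
  I [::] s0 ->
  (forall visited (t : seq nat) s, t \in grid Ns ->
     [seq imem s loop_arr [:: xb.1] | xb <- xbs] = t ->
     (forall a, (a < 2) -> imem s a = imem s0 a) ->
     I visited s -> I (rcons visited t) (run p s)) ->
  I (grid Ns) (run (fors xbs p) s0).
Proof.
elim: xbs xs I s0 => [|[x b] xbs IH] xs I s0 /=.
  by move=> _ _ h0 /(_ [::] [::] s0) /=; apply.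
move=> w hsim h0 hS; case/and3P: (w) => xxs ltb w'.
set Ns := [seq imem s0 xb.2 [::] | xb <- xbs] in hS *.
set N := imem s0 b [::] in hS *.
pose pre k := flatten [seq [seq j :: t | t <- grid Ns] | j <- iota 0 k].
apply: (@for_ind xs x b (fors xbs p) (fun k => I (pre k))) => //.
  move=> k s s' [rE iE lE]; apply: hsim; split=> // y yx; apply: lE.
  by apply: contra yx; rewrite !inE => ->.
move=> k s ltk xk lowE Ik.
have xN : x \notin [seq xb.1 | xb <- xbs].
  by apply: wf_fors_disjoint w' _; rewrite inE eqxx.
have NsE : [seq imem s xb.2 [::] | xb <- xbs] = Ns.
  rewrite /Ns; elim: (xbs) (x :: xs) w' => //= -[y b'] l IHl ys.
  case/and3P=> _ ltb' wl.
  by rewrite /= lowE // (IHl _ wl).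
have := IH (x :: xs) (fun visited s' => [/\ imem s' loop_arr [:: x] = k,
    (forall a, (a < 2) -> imem s' a = imem s0 a)
  & I (pre k ++ [seq k :: t | t <- visited]) s']) s w'.
rewrite NsE => /(_ _ _ _) [].
- move=> visited s1 s2 [rE iE lE] [xE low1 I1]; split.
  + by rewrite -lE.
  + by move=> a lta; rewrite -iE ?low1 //; case: a lta => [|[|[|]]].
  apply: hsim I1; split=> // y; rewrite inE negb_or => /andP[_]; exact: lE.
- by rewrite cats0.
- have [xs' wp sub] := wf_fors_body w'.
  move=> visited t s1 tin tE low1 [xE low1' I1]; split.
  + by rewrite (run_lv _ wp) ?sub // inE eqxx.
  + by move=> a lta; rewrite (run_size _ wp) ?low1'.
  rewrite map_rcons -rcons_cat; apply: hS => //; last by rewrite xE tE.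
  by apply/flatten_mapP; exists k; rewrite ?mem_iota // map_f.
move=> _ _; rewrite /pre -[k.+1]addn1 iotaD map_cat flatten_cat /= cats0 add0n.
by [].
Qed.

(** Nested loops whose body adds a term to a cell compute sums.  The terms [f t]
    and the cells [g t] must not depend on the array being written. *)
Lemma run_summation xs xbs a idx e s0 (f : seq nat -> R) g :
  let Ns := [seq imem s0 xb.2 [::] | xb <- xbs] in
  let p := fors xbs (PRSet a idx (RAdd (RGet a idx) e)) in
  wf xs p ->
  (forall (t : seq nat) s, t \in grid Ns ->
     [seq imem s loop_arr [:: xb.1] | xb <- xbs] = t ->
     (forall a', a' != loop_arr -> imem s a' = imem s0 a') ->
     (forall a', a' != a -> rmem s a' = rmem s0 a') ->
     map (ieval (imem s)) idx = g t /\ reval s e = f t) ->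
  forall l, rmem (run p s0) a l
            = (rmem s0 a l + \sum_(t <- grid Ns | g t == l) f t)%R.
Proof.
move=> Ns p w h.
pose I visited (s : state R) := [/\
  forall a', a' != loop_arr -> imem s a' = imem s0 a',
  forall a', a' != a -> rmem s a' = rmem s0 a'
  & forall l,
    rmem s a l = (rmem s0 a l + \sum_(t <- visited | g t == l) f t)%R].
suff [] : I (grid Ns) (run p s0) by [].
apply: (fors_ind w).
- move=> visited s s' [rE iE _] [i1 r1 a1].
  split=> [a' a2|a' aa|l]; first by rewrite -iE ?i1.
    by rewrite -rE r1.
  by rewrite -rE a1.
- by split=> // l; rewrite big_nil addr0.
- move=> visited t s tin tE _ [i1 r1 a1]; have [gE fE] := h t s tin tE i1 r1.
  split=> [//|a' aa|l]; first by rewrite /= update_other // r1.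
  rewrite /= update_same gE fE a1 big_rcons /= -addrA eq_sym.
  by case: eqP => [->|_]; rewrite // a1 addr0.
Qed.

End Runs.

(** When the cell is addressed by the outer indices [l], the sum ranges over the
    inner ones. *)
Lemma grid_prefix_sum (V : nmodType) Ns1 Ns2 l (f : seq nat -> V) :
  l \in grid Ns1 ->
  (\sum_(t <- grid (Ns1 ++ Ns2) | take (size l) t == l) f t
   = \sum_(t <- grid Ns2) f (l ++ t))%R.
Proof.
elim: Ns1 l f => [|N Ns1 IH] [|j l] f; rewrite mem_grid //=.
  by move=> _; apply: eq_bigl => t; rewrite take0.
case/andP=> ltj lin; rewrite big_flatten big_map.
rewrite (bigD1_seq j) ?iota_uniq ?mem_iota //=.
rewrite [X in (_ + X)%R]big1 ?addr0 => [|k kj]; last first.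
  by rewrite big_map big1 // => t /=; rewrite eqseq_cons (negPf kj).
rewrite big_map -(IH l (fun t => f (j :: t))) ?mem_grid //.
by apply: eq_bigl => t; rewrite /= eqseq_cons eqxx.
Qed.

Lemma grid_cons_sum (V : nmodType) N Ns (f : seq nat -> V) :
  (\sum_(t <- grid (N :: Ns)) f t
   = \sum_(i < N) \sum_(t <- grid Ns) f (val i :: t))%R.
Proof.
rewrite /= big_flatten big_map -[N in LHS]subn0 -/(index_iota 0 N) big_mkord.
by apply: eq_bigr => i _; rewrite big_map.
Qed.

Arguments grid : simpl never.

Local Open Scope ring_scope.

(** * The program *)

(** Real arrays.  [sq_arr] holds [|A_i|^2], [prod_arr] the entries of [A_j A_i]
    at index [i, j], [psq_arr] the numbers [|A_j A_i|^2], [walk_arr] the values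
    of [minw], and cell [k] of [count_arr] the real number [k]: the machine
    cannot convert naturals to reals. *)
Notation in_arr := 0%N (only parsing).
Notation out_arr := 1%N (only parsing).
Notation sq_arr := 2%N (only parsing).
Notation prod_arr := 3%N (only parsing).
Notation psq_arr := 4%N (only parsing).
Notation walk_arr := 5%N (only parsing).
Notation count_arr := 6%N (only parsing).

(** Natural number arrays.  [pred_arr] holds predecessors, [len_var] and
    [root_var] the best closed walk, [cur_var] the current vertex when it is
    traced back, and [next_arr] the successor map of the chain. *)
Notation pred_arr := 3%N (only parsing).
Notation len_var := 4%N (only parsing).
Notation root_var := 5%N (only parsing).
Notation cur_var := 6%N (only parsing).
Notation next_arr := 7%N (only parsing).

Definition squares : prog :=
  let cell := [:: lv 0] in
  let x := RGet in_arr [:: lv 0; lv 1; lv 2] in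
  fors [:: (0, 0); (1, 1); (2, 1)]%N
    (PRSet sq_arr cell (RAdd (RGet sq_arr cell) (RMul x x))).

Definition products : prog :=
  let cell := [:: lv 0; lv 1; lv 2; lv 3] in
  fors [:: (0, 0); (1, 0); (2, 1); (3, 1); (4, 1)]%N
    (PRSet prod_arr cell (RAdd (RGet prod_arr cell)
       (RMul (RGet in_arr [:: lv 1; lv 2; lv 4])
             (RGet in_arr [:: lv 0; lv 4; lv 3])))).

Definition product_squares : prog :=
  let cell := [:: lv 0; lv 1] in
  let x := RGet prod_arr [:: lv 0; lv 1; lv 2; lv 3] in
  fors [:: (0, 0); (1, 0); (2, 1); (3, 1)]%N
    (PRSet psq_arr cell (RAdd (RGet psq_arr cell) (RMul x x))).

Definition weight (x y : iexpr) : rexpr :=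
  RSub (RLn (RGet psq_arr [:: x; y])) (RLn (RGet sq_arr [:: x])).

Definition edges : prog :=
  let cell := [:: ICst 0; lv 0; lv 1] in
  fors [:: (0, 0); (1, 0)]%N
    (PRSet walk_arr cell (RAdd (RGet walk_arr cell) (weight (lv 0) (lv 1)))).

Definition via_expr (x : iexpr) : rexpr :=
  RAdd (RGet walk_arr [:: lv 0; lv 1; x]) (weight x (lv 2)).

(** For fixed [k], finds the best last-but-one vertex of the walks of [k + 2]
    edges.  A predecessor cell is initially 0, which is a vertex, so the
    comparison makes sense from the start. *)
Definition extend : prog :=
  let cell := [:: IAdd (lv 0) (ICst 1); lv 1; lv 2] in
  fors [:: (1, 0); (2, 0); (3, 0)]%N
    (PSeq (PIf (BRLt (via_expr (lv 3)) (via_expr (IGet pred_arr cell)))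
             (PISet pred_arr cell (lv 3)))
          (PRSet walk_arr cell (via_expr (IGet pred_arr cell)))).

Definition longer_walks : prog :=
  PFor 0 0
    (PSeq (PRSet count_arr [:: IAdd (lv 0) (ICst 1)]
             (RAdd (RGet count_arr [:: lv 0]) (RCst 1)))
          extend).

Definition mean_expr (k x : iexpr) : rexpr :=
  RDiv (RGet walk_arr [:: k; x; x]) (RGet count_arr [:: IAdd k (ICst 1)]).

Definition best_update : prog :=
  PIf (BRLt (mean_expr (lv 0) (lv 1))
            (mean_expr (IGet len_var [::]) (IGet root_var [::])))
    (PSeq (PISet len_var [::] (lv 0)) (PISet root_var [::] (lv 1))).

(** Lengths increase in the outer loop and an update needs strict improvement,
    so the walk found has the fewest edges among the best ones. *)
Definition best_closed_walk : prog := PFor 0 0 (PFor 1 0 best_update).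

(** Traces the best closed walk backwards from its root.  The last assignment
    adds the edge that leaves the root. *)
Definition follow : prog :=
  let root := IGet root_var [::] in
  let cur := IGet cur_var [::] in
  let pred := IGet pred_arr [:: ISub (IGet len_var [::]) (lv 0); root; cur] in
  PSeq (PFor 0 0 (PISet next_arr [:: lv 0] root))
  (PSeq (PISet cur_var [::] root)
  (PSeq (PFor 0 0 (PIf (BILt (lv 0) (IGet len_var [::]))
                     (PSeq (PISet next_arr [:: pred] cur)
                           (PISet cur_var [::] pred))))
        (PISet next_arr [:: root] cur))).

(** Overwrites the cycle found by a cycle of value [-oo], if there is one. *)
Definition zero_edges : prog :=
  fors [:: (0, 0); (1, 0)]%N
    (PIf (BNot (BRLt (RCst 0) (RGet psq_arr [:: lv 0; lv 1])))
       (PSeq (PFor 2 0 (PISet next_arr [:: lv 2] (lv 0)))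
             (PISet next_arr [:: lv 0] (lv 1)))).

Definition emit : prog :=
  let cell := [:: lv 0; IGet next_arr [:: lv 0]] in
  fors [:: (0, 0)]%N (PRSet out_arr cell (RAdd (RGet out_arr cell) (RCst 1))).

Section Stages.
Variables (R : realType) (n d : nat).
Implicit Types s : state R.

Definition sizes s := imem s 0%N [::] = n /\ imem s 1%N [::] = d.

Lemma run_sizes xs p s : wf xs p -> sizes s -> sizes (run p s).
Proof. by move=> w [? ?]; rewrite /sizes !(run_size _ w). Qed.

Lemma run_squares s (i : 'I_n) : sizes s -> (forall l, rmem s sq_arr l = 0) ->
  rmem (run squares s) sq_arr [:: val i]
  = \sum_(j < d) \sum_(k < d) rmem s in_arr [:: val i; val j; val k] ^+ 2.
Proof.
move=> [nE dE] z.
rewrite (run_summation (xs := [::])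
    (f := fun t => rmem s in_arr t ^+ 2) (g := take 1))
  //= => [|t s1 _ <- iE rE]; last by rewrite rE // expr2.
rewrite z add0r nE dE.
rewrite (@grid_prefix_sum _ [:: n] [:: d; d] [:: val i])
  ?mem_grid /= ?ltn_ord //.
rewrite grid_cons_sum; apply: eq_bigr => j _.
rewrite grid_cons_sum; apply: eq_bigr => k _.
by rewrite big_seq1.
Qed.

Lemma run_products s (i j : 'I_n) (a b : 'I_d) :
  sizes s -> (forall l, rmem s prod_arr l = 0) ->
  rmem (run products s) prod_arr [:: val i; val j; val a; val b]
  = \sum_(k < d) rmem s in_arr [:: val j; val a; val k]
                 * rmem s in_arr [:: val i; val k; val b].
Proof.
move=> [nE dE] z.
rewrite (run_summation (xs := [::]) (g := take 4) (f := fun t =>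
    rmem s in_arr [:: nth 0 t 1; nth 0 t 2; nth 0 t 4]%N
    * rmem s in_arr [:: nth 0 t 0; nth 0 t 4; nth 0 t 3]%N))
  //= => [|t s1 _ <- iE rE]; last by rewrite rE.
rewrite z add0r nE dE.
rewrite (@grid_prefix_sum _ [:: n; n; d; d] [:: d]
  [:: val i; val j; val a; val b]) ?mem_grid /= ?ltn_ord //.
rewrite grid_cons_sum; apply: eq_bigr => k _.
by rewrite big_seq1.
Qed.

Lemma run_product_squares s (i j : 'I_n) :
  sizes s -> (forall l, rmem s psq_arr l = 0) ->
  rmem (run product_squares s) psq_arr [:: val i; val j]
  = \sum_(a < d) \sum_(b < d)
      rmem s prod_arr [:: val i; val j; val a; val b] ^+ 2.
Proof.
move=> [nE dE] z.
rewrite (run_summation (xs := [::])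
    (f := fun t => rmem s prod_arr t ^+ 2) (g := take 2))
  //= => [|t s1 _ <- iE rE]; last by rewrite rE // expr2.
rewrite z add0r nE dE.
rewrite (@grid_prefix_sum _ [:: n; n] [:: d; d] [:: val i; val j])
  ?mem_grid /= ?ltn_ord //.
rewrite grid_cons_sum; apply: eq_bigr => a _.
rewrite grid_cons_sum; apply: eq_bigr => b _.
by rewrite big_seq1.
Qed.

Definition edge_weight s (i j : nat) : R :=
  ln (rmem s psq_arr [:: i; j]) - ln (rmem s sq_arr [:: i]).

Lemma run_edges s k (i j : 'I_n) :
  sizes s -> (forall l, rmem s walk_arr l = 0) ->
  rmem (run edges s) walk_arr [:: k; val i; val j]
  = if k is 0 then edge_weight s i j else 0.
Proof.
move=> [nE dE] z.
rewrite (run_summation (xs := [::]) (g := fun t => 0%N :: take 2 t)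
    (f := fun t => edge_weight s (nth 0 t 0) (nth 0 t 1))%N)
  //= => [|t s1 _ <- iE rE]; last by rewrite /edge_weight !rE.
rewrite z add0r nE; case: k => [|k]; last by rewrite big_pred0.
under eq_bigl do rewrite eqseq_cons eqxx.
rewrite (@grid_prefix_sum _ [:: n; n] [::] [:: val i; val j])
  ?mem_grid /= ?ltn_ord //.
by rewrite big_seq1.
Qed.

Lemma reval_via s (w : 'I_n -> 'I_n -> R) k (x y z : 'I_n) e :
  (forall i j : 'I_n, edge_weight s i j = w i j) ->
  imem s loop_arr [:: 0]%N = k -> imem s loop_arr [:: 1]%N = x ->
  imem s loop_arr [:: 2]%N = y ->
  ieval (imem s) e = z -> rmem s walk_arr [:: k; val x; val z] = minw w k x z ->
  reval s (via_expr e) = minw w k x z + w z y.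
Proof. by move=> wE /= -> -> -> -> ->; rewrite -wE. Qed.

(** The invariant holds the best predecessor among the last vertices visited
    so far; uniqueness of the minimum identifies the value at the end. *)
Lemma run_extend s (w : 'I_n -> 'I_n -> R) k :
  (0 < n)%N -> sizes s -> (forall i j : 'I_n, edge_weight s i j = w i j) ->
  imem s loop_arr [:: 0]%N = k ->
  (forall x y : 'I_n, rmem s walk_arr [:: k; val x; val y] = minw w k x y) ->
  (forall l, imem s pred_arr (k.+1 :: l) = 0%N) ->
  let s' := run extend s in
  [/\ forall j l, j != k.+1 ->
        rmem s' walk_arr (j :: l) = rmem s walk_arr (j :: l),
      forall j l, j != k.+1 ->
        imem s' pred_arr (j :: l) = imem s pred_arr (j :: l)
    & forall x y : 'I_n, exists z : 'I_n,
        [/\ imem s' pred_arr [:: k.+1; val x; val y] = z,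
            rmem s' walk_arr [:: k.+1; val x; val y] = minw w k.+1 x y
          & minw w k x z + w z y = minw w k.+1 x y]].
Proof.
move=> n0 [nE dE] wE kE Ek p0.
pose via (x y z : 'I_n) := minw w k x z + w z y.
pose I (visited : seq (seq nat)) s' := [/\ imem s' loop_arr [:: 0]%N = k,
  forall a, a != walk_arr -> rmem s' a = rmem s a,
  forall j l, j != k.+1 -> rmem s' walk_arr (j :: l) = rmem s walk_arr (j :: l),
  forall j l, j != k.+1 -> imem s' pred_arr (j :: l) = imem s pred_arr (j :: l)
& forall x y : 'I_n, exists2 z : 'I_n,
    imem s' pred_arr [:: k.+1; val x; val y] = z &
    forall t : 'I_n, [:: val x; val y; val t] \in visited ->
      via x y z <= via x y t
      /\ rmem s' walk_arr [:: k.+1; val x; val y] = via x y z].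
suff [_ _ h1 h2 h3] : I (grid [:: n; n; n]) (run extend s).
  split=> // x y; have [z zE zle] := h3 x y.
  have {}zle (t : 'I_n) : via x y z <= via x y t
      /\ rmem (run extend s) walk_arr [:: k.+1; val x; val y] = via x y z.
    by apply: zle; rewrite mem_grid /= !ltn_ord.
  have zu : via x y z = minw w k.+1 x y.
    by apply: minw_unique => t; case: (zle t).
  by exists z; split=> //; rewrite -zu; case: (zle (Ordinal n0)).
rewrite -{1 2 3}nE; apply: (@fors_ind R [:: 0%N] [:: (1, 0); (2, 0); (3, 0)]%N).
- by [].
- move=> visited s1 s2 [rE iE lE] [a1 a2 a3 a4 a5]; split.
  + by rewrite -lE.
  + by rewrite -rE.
  + by rewrite -rE.
  + by rewrite -iE.
  + by rewrite -rE -iE.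
- split=> // x y; exists (Ordinal n0) => //; rewrite p0 //.
move=> visited t s1 tin tE _ [a1 a2 a3 a4 a5]; move: tin.
rewrite mem_grid -tE [all2 _ _ _]/= nE.
set lx := imem s1 _ [:: 1%N]; set ly := imem s1 _ [:: 2%N].
set lc := imem s1 _ [:: 3%N] => /and4P[ltx lty ltc _].
rewrite [X in rcons visited X]/= -/lx -/ly -/lc.
pose x := Ordinal ltx; pose y := Ordinal lty; pose c := Ordinal ltc.
have [z zE zle] := a5 x y.
have w1E (i j : 'I_n) : edge_weight s1 i j = w i j.
  by rewrite -wE /edge_weight !a2.
have E1 (i : 'I_n) : rmem s1 walk_arr [:: k; val x; val i] = minw w k x i.
  by rewrite -Ek a3 // neq_ltn ltnSn.
pose cell := [:: IAdd (lv 0) (ICst 1); lv 1; lv 2].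
have cellE s' : imem s' loop_arr = imem s1 loop_arr ->
    map (ieval (imem s')) cell = [:: k.+1; val x; val y].
  by move=> lE; rewrite /= !lE a1 addn1.
have viaE s' e (j : 'I_n) :
    rmem s' = rmem s1 -> imem s' loop_arr = imem s1 loop_arr ->
    ieval (imem s') e = j -> reval s' (via_expr e) = via x y j.
  move=> rE lE eE; apply: reval_via => //; rewrite ?lE ?rE //.
  by move=> i1 j1; rewrite -w1E /edge_weight rE.
pose z' := if via x y c < via x y z then c else z.
set s2 := run (PIf (BRLt (via_expr (lv 3)) (via_expr (IGet pred_arr cell)))
                   (PISet pred_arr cell (lv 3))) s1.
rewrite -[run _ s1]/(rset s2 walk_arr cell (via_expr (IGet pred_arr cell))).
have zE1 : ieval (imem s1) (IGet pred_arr cell) = z.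
  by rewrite -zE -(cellE s1).
have [r2 l2 q2] : [/\ rmem s2 = rmem s1, imem s2 loop_arr = imem s1 loop_arr
    & forall l, imem s2 pred_arr l
                = if l == [:: k.+1; val x; val y] then val z'
                  else imem s1 pred_arr l].
  rewrite /s2 /run /beval (viaE s1 _ c) // (viaE s1 _ z) // /z'.
  case: ifP => _; split=> // l; last by case: eqP => // ->.
  by rewrite imem_iset cellE.
have f2 a : a != loop_arr -> a != pred_arr -> imem s2 a = imem s1 a.
  by move=> na nb; apply: run_iframe; rewrite ?inE.
have zE2 : reval s2 (via_expr (IGet pred_arr cell)) = via x y z'.
  apply: viaE => //.
  rewrite -[ieval _ _]/(imem s2 pred_arr (map (ieval (imem s2)) cell)).
  by rewrite cellE // q2 eqxx.
have le_z' : via x y z' <= via x y z /\ via x y z' <= via x y c.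
  by rewrite /z'; case: ltP => // /ltW.
split.
- by rewrite -a1 -l2.
- by move=> a na; rewrite /= update_other // r2 a2.
- move=> j l jk; rewrite rmem_rset cellE // eqseq_cons (negPf jk) /=.
  by rewrite r2 a3.
- by move=> j l jk; rewrite /rset [imem _]/= q2 eqseq_cons (negPf jk) a4.
move=> x' y'; rewrite rmem_rset cellE // /rset [imem _]/= q2.
rewrite zE2 !eqseq_cons !eqxx andbT andTb !val_eqE.
have [->|x'x] := eqVneq x' x; have [->|y'y] := eqVneq y' y => /=.
- exists z' => // t'; rewrite mem_rcons inE => /predU1P[[e]|tin].
    by rewrite (_ : t' = c); [case: le_z'|apply: val_inj].
  by split=> //; apply: le_trans (le_z'.1) (zle _ tin).1.
- have [z0 z0E z0le] := a5 x y'; exists z0 => // t'.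
  rewrite mem_rcons inE r2 => /predU1P[[] e *|]; last exact: z0le.
  by rewrite -val_eqE /= e eqxx in y'y.
- have [z0 z0E z0le] := a5 x' y; exists z0 => // t'.
  rewrite mem_rcons inE r2 => /predU1P[[] e *|]; last exact: z0le.
  by rewrite -val_eqE /= e eqxx in x'x.
- have [z0 z0E z0le] := a5 x' y'; exists z0 => // t'.
  rewrite mem_rcons inE r2 => /predU1P[[] e *|]; last exact: z0le.
  by rewrite -val_eqE /= e eqxx in x'x.
Qed.

Definition walks_upto (w : 'I_n -> 'I_n -> R) k s :=
  [/\ forall j, (j <= k)%N -> rmem s count_arr [:: j] = j%:R,
      forall j (x y : 'I_n), (j <= k)%N ->
        rmem s walk_arr [:: j; val x; val y] = minw w j x y
    & forall j (x y : 'I_n), (j < k)%N -> exists2 z : 'I_n,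
        imem s pred_arr [:: j.+1; val x; val y] = z
        & minw w j x z + w z y = minw w j.+1 x y].

Lemma run_longer_walks s (w : 'I_n -> 'I_n -> R) :
  (0 < n)%N -> sizes s -> (forall i j : 'I_n, edge_weight s i j = w i j) ->
  (forall x y : 'I_n, rmem s walk_arr [:: 0%N; val x; val y] = w x y) ->
  rmem s count_arr [:: 0%N] = 0 -> (forall l, imem s pred_arr l = 0%N) ->
  walks_upto w n (run longer_walks s).
Proof.
move=> n0 [nE dE] wE E0 c0 p0.
pose I k s' := [/\
  forall a, a != walk_arr -> a != count_arr -> rmem s' a = rmem s a,
  walks_upto w k s' & forall j l, (k < j)%N -> imem s' pred_arr (j :: l) = 0%N].
suff [] : I n (run longer_walks s) by [].
rewrite -{1}nE; apply: (@for_ind R [::] _ _ _ I) => //.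
- move=> k s1 s2 [rE iE _] [a1 [a2 a3 a4] a5]; rewrite /I /walks_upto -rE.
  by rewrite -iE.
- split=> //; split=> [[]//|[]//|//].
move=> k s1 ltk kE lowE [a1 [a2 a3 a4] a5].
rewrite -[run _ s1]/(run extend (rset s1 count_arr [:: IAdd (lv 0) (ICst 1)]
  (RAdd (RGet count_arr [:: lv 0]) (RCst 1)))).
set s2 := rset _ _ _ _.
have r2 a : a != count_arr -> rmem s2 a = rmem s1 a by exact: rmem_rset_other.
have s2E : rmem s2 count_arr [:: k.+1] = k.+1%:R.
  by rewrite rmem_rset /= kE addn1 eqxx a2 // natr1.
have sz2 : sizes s2 by split; rewrite /= lowE.
have w2 (i j : 'I_n) : edge_weight s2 i j = w i j.
  by rewrite -wE /edge_weight !r2 // !a1.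
have [|l|h1 h2 h3] := run_extend n0 sz2 w2 kE.
- by move=> x y; rewrite r2 // a3.
- by rewrite a5.
have r3 a : a != walk_arr -> rmem (run extend s2) a = rmem s2 a.
  by move=> na; apply: run_rframe; rewrite inE.
split.
- by move=> a na nb; rewrite r3 // r2 // a1.
- split=> [j|j x y|j x y lej].
  + rewrite leq_eqVlt => /predU1P[->|ltj]; first by rewrite r3.
    rewrite r3 // rmem_rset [map _ _]/= kE addn1 eqseq_cons (ltn_eqF ltj).
    exact: a2.
  + rewrite leq_eqVlt => /predU1P[->|ltj]; first by have [z []] := h3 x y.
    by rewrite h1 ?ltn_eqF // r2 // a3.
  + move: lej; rewrite ltnS leq_eqVlt => /predU1P[->|ltj].
      by have [z [zE _ zm]] := h3 x y; exists z.
    by rewrite h2 ?eqSS ?ltn_eqF //; apply: a4.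
- by move=> j l ltj; rewrite h2 ?gtn_eqF // a5 // ltnW.
Qed.

Definition mean_walk (w : 'I_n -> 'I_n -> R) k x := minw w k x x / k.+1%:R.

(** The two invariants compare the current candidate with all shorter closed
    walks and with the part of the current length seen so far. *)
Lemma run_best_closed_walk s (w : 'I_n -> 'I_n -> R) :
  (0 < n)%N -> sizes s -> walks_upto w n s ->
  imem s len_var [::] = 0%N -> imem s root_var [::] = 0%N ->
  let s' := run best_closed_walk s in
  exists k (x : 'I_n),
    [/\ imem s' len_var [::] = k, imem s' root_var [::] = x, (k < n)%N,
        forall j y, (j < n)%N -> mean_walk w k x <= mean_walk w j y
      & forall j y, (j < k)%N -> mean_walk w k x < mean_walk w j y].
Proof.
move=> n0 [nE dE] [c2 c3 _] len0 root0.
pose J (P : nat -> 'I_n -> Prop) s' := rmem s' = rmem s /\ exists k (x : 'I_n),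
  [/\ imem s' len_var [::] = k, imem s' root_var [::] = x, (k < n)%N,
      forall j y, P j y -> mean_walk w k x <= mean_walk w j y
    & forall j y, (j < k)%N -> mean_walk w k x < mean_walk w j y].
have Jsim P xs s1 s2 : sim xs s1 s2 -> J P s1 -> J P s2.
  move=> [rE iE _] [a1 [k [x a2]]].
  by split; [rewrite -rE|exists k, x; rewrite -!iE].
suff [_] : J (fun j _ => (j < n)%N) (run best_closed_walk s) by [].
rewrite -[X in J (fun j _ => (j < X)%N)]nE.
apply: (@for_ind R [::] _ _ _ (fun k => J (fun j _ => (j < k)%N))) => //.
- by move=> k s1 s2; apply: Jsim.
- by split=> //; exists 0%N, (Ordinal n0).
move=> k s1 ltk kE lowE Jk.
(* The closed walks seen when the inner loop has reached root [i]. *)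
pose P i j (y : 'I_n) := (j < k)%N \/ j = k /\ (y < i)%N.
have n1 : imem s1 0%N [::] = n by rewrite lowE ?nE.
suff [_ Jn] : imem (run (PFor 1 0 best_update) s1) loop_arr [:: 0%N] = k
    /\ J (P n) (run (PFor 1 0 best_update) s1).
  case: Jn => r1 [K [x [h1 h2 h3 h4 h5]]]; split=> //.
  exists K, x; split=> // j y.
  by rewrite ltnS leq_eqVlt => /predU1P[->|ltj]; apply: h4; [right|left].
rewrite -[X in J (P X)]n1.
apply: (@for_ind R [:: 0%N] _ _ _ (fun i s' =>
  imem s' loop_arr [:: 0%N] = k /\ J (P i) s')) => //.
- move=> i s2 s3 sim23 [e Ji]; split; last exact: Jsim sim23 Ji.
  by case: sim23 => _ _ <-.
- split=> //; case: Jk => r1 [K [x [h1 h2 h3 h4 h5]]]; split=> //.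
  exists K, x; split=> // j y [|[_]] //; exact: h4.
move=> i s2; rewrite n1 => lti iE _ [k2 [r2 [K [x [h1 h2 h3 h4 h5]]]]].
split; first by rewrite (@run_lv _ [:: 0%N; 1%N]).
pose y := Ordinal lti.
have meanE k' (z : 'I_n) e1 e2 :
    ieval (imem s2) e1 = k' -> ieval (imem s2) e2 = z ->
    (k' < n)%N -> reval s2 (mean_expr e1 e2) = mean_walk w k' z.
  by move=> /= -> -> ltk'; rewrite r2 addn1 c3 ?c2 // ltnW.
have nk : (k < n)%N by rewrite -nE.
rewrite /best_update /run /beval (meanE k y) // (meanE K x) //.
case: ifP => [lt|/negbT]; last rewrite -leNgt => ge.
  split=> //; exists k, y; split=> //.
  - move=> j z [ltj|[-> ]].
      by apply/ltW/(lt_le_trans lt)/h4; left.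
    rewrite ltnS leq_eqVlt => /predU1P[zi|ltz].
      by rewrite (_ : z = y) //; apply: val_inj.
    by apply/ltW/(lt_le_trans lt)/h4; right.
  - by move=> j z ltj; apply/(lt_le_trans lt)/h4; left.
split=> //; exists K, x; split=> // j z [ltj|[-> ]].
  by apply: h4; left.
rewrite ltnS leq_eqVlt => /predU1P[zi|ltz]; last by apply: h4; right.
by rewrite (_ : z = y) //; apply: val_inj.
Qed.

(** After [t] steps the first [min t k] predecessors in the trace have their
    successors; distinct vertices make these assignments independent. *)
Lemma run_follow s (pr : nat -> 'I_n -> 'I_n -> 'I_n) k (r : 'I_n) :
  let c := r :: trace pr k r r in
  sizes s -> imem s len_var [::] = k -> imem s root_var [::] = r -> (k < n)%N ->
  (forall j x, (j < k)%N ->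
     imem s pred_arr [:: j.+1; val r; val x] = pr j.+1 r x) ->
  uniq c ->
  forall x : 'I_n, imem (run follow s) next_arr [:: val x] = cycle_map c r x.
Proof.
set tr := trace pr k r r => c [nE dE] lenE rootE ltk predE Uc.
have sz : size tr = k by exact: size_trace.
set p1 := PFor 0 0 (PISet next_arr [:: lv 0] (IGet root_var [::])).
pose I1 i s' := imem s' root_var [::] = r
  /\ forall x, (x < i)%N -> imem s' next_arr [:: x] = r.
have {I1} [_ next1] : I1 n (run p1 s).
  rewrite -nE; apply: (@for_ind R [::] _ _ _ I1) => //.
    by move=> i s1 s2 [_ iE _] [a1 a2]; rewrite /I1 -!iE.
  move=> i s1 _ iE _ [a1 a2]; split=> // x; rewrite ltnS => lex.
  rewrite imem_iset /= iE eqseq_cons andbT a1.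
  by case: eqP lex => // /eqP xi lex; rewrite a2 // ltn_neqAle xi.
pose pred_expr := IGet pred_arr [:: ISub (IGet len_var [::]) (lv 0);
  IGet root_var [::]; IGet cur_var [::]].
set body := PIf (BILt (lv 0) (IGet len_var [::]))
  (PSeq (PISet next_arr [:: pred_expr] (IGet cur_var [::]))
        (PISet cur_var [::] pred_expr)).
set s2 := iset (run p1 s) cur_var [::] (IGet root_var [::]).
have low2 a : a != loop_arr -> a != next_arr -> a != cur_var ->
    imem s2 a = imem s a.
  move=> n2 n7 n6; rewrite imem_iset_other //.
  by apply: run_iframe; rewrite ?inE.
pose I t s' := [/\ forall a, a != loop_arr -> a != next_arr -> a != cur_var ->
     imem s' a = imem s a,
   imem s' cur_var [::] = nth r c (minn t k)
 & forall x : 'I_n, imem s' next_arr [:: val x]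
     = if x \in take (minn t k) tr then prev c x else r].
set s3 := run (PFor 0 0 body) s2.
have [a1 a2 a3] : I n s3.
  have nE2 : imem s2 0%N [::] = n by rewrite low2 // nE.
  rewrite -[X in I X]nE2.
  apply: (@for_ind R [::] _ _ _ I) => //.
  - move=> t s4 s5 [_ iE _] [b1 b2 b3]; split.
    + by move=> a n2 n7 n6; rewrite -iE ?b1.
    + by rewrite -iE.
    + by move=> x; rewrite -iE.
  - split=> //; first by rewrite min0n /= /s2 /= (run_iframe (p := p1)) ?inE.
    move=> x; rewrite min0n take0 in_nil -(next1 x) //.
  move=> t s4 ltt tE lowE [b1 b2 b3].
  rewrite /body /run /beval /= tE b1 // lenE.
  case: ltnP => [lttk|lekt]; last first.
    by rewrite /I (minn_idPr (leqW lekt)) -(minn_idPr lekt).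
  have mt : minn t k = t by apply/minn_idPl/ltnW.
  have mt1 : minn t.+1 k = t.+1 by apply/minn_idPl.
  rewrite mt in b2 b3.
  have curE : imem s4 pred_arr [:: (k - t)%N; val r; imem s4 cur_var [::]]
              = nth r tr t.
    have kt : (k - t)%N = (k - t).-1.+1 by rewrite prednK // subn_gt0.
    rewrite b2 b1 // kt predE; last by lia.
    by rewrite -kt -nth_trace.
  have zE : ieval (imem s4) pred_expr = nth r tr t.
    by rewrite /= tE (b1 len_var) // (b1 root_var) // lenE rootE -curE.
  set s5 := iset s4 _ _ _.
  have zE5 : ieval (imem s5) pred_expr = nth r tr t by rewrite -zE.
  have next5 (x : 'I_n) : imem s5 next_arr [:: val x]
      = if x == nth r tr t then val (nth r c t)
        else imem s4 next_arr [:: val x].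
    rewrite imem_iset (_ : map _ _ = [:: val (nth r tr t)]).
      by rewrite eqseq_cons andbT val_eqE /= b2.
    exact: (congr1 (fun y => [:: y]) zE).
  have ltt' : (t < size tr)%N by rewrite sz.
  rewrite /I mt1; split.
  - by move=> a n2 n7 n6; rewrite !imem_iset_other ?b1.
  - by rewrite imem_iset eqxx zE5.
  move=> x; rewrite imem_iset_other // next5 b3 (take_nth r) // mem_rcons inE.
  case: eqP => [->|_]; last by [].
  have <- : nth r (rcons tr r) t = nth r tr t by rewrite nth_rcons ltt'.
  by rewrite (prev_nth_uniq r Uc) // ltnW.
move=> x; rewrite -[run follow s]/(iset s3 next_arr [:: IGet root_var [::]]
  (IGet cur_var [::])).
have mnk : minn n k = k by apply/minn_idPr/ltnW.
rewrite imem_iset /= a1 // rootE a2 a3 mnk eqseq_cons andbT val_eqE.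
rewrite take_oversize ?sz // /cycle_map inE.
case: eqP => [->|_]; last by [].
have := prev_nth_uniq r Uc (leqnn (size tr)).
by rewrite nth_rcons ltnn eqxx sz => ->.
Qed.

Lemma run_zero_edges s : sizes s ->
  let s' := run zero_edges s in
  ((forall i j : 'I_n, 0 < rmem s psq_arr [:: val i; val j])
   /\ imem s' next_arr = imem s next_arr)
  \/ exists i j : 'I_n, ~~ (0 < rmem s psq_arr [:: val i; val j])
     /\ forall x : 'I_n, imem s' next_arr [:: val x] = if x == i then j else i.
Proof.
move=> [nE dE].
pose I (visited : seq (seq nat)) s' := rmem s' = rmem s /\
  (((forall i j : 'I_n, [:: val i; val j] \in visited ->
       0 < rmem s psq_arr [:: val i; val j])
    /\ imem s' next_arr = imem s next_arr)
  \/ exists i j : 'I_n, ~~ (0 < rmem s psq_arr [:: val i; val j])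
     /\ forall x : 'I_n, imem s' next_arr [:: val x] = if x == i then j else i).
suff [_ [[h1 h2]|h]] : I (grid [:: n; n]) (run zero_edges s).
- by left; split=> // i j; apply: h1; rewrite mem_grid /= !ltn_ord.
- by right.
rewrite -{1 2}nE; apply: (@fors_ind R [::] [:: (0, 0); (1, 0)]%N).
- by [].
- by move=> visited s1 s2 [rE iE _]; rewrite /I -rE -iE.
- by split=> //; left.
move=> visited t s1 tin tE lowE [r1 h]; move: tin.
rewrite mem_grid -tE [all2 _ _ _]/= nE.
set li := imem s1 _ [:: 0%N]; set lj := imem s1 _ [:: 1%N] => /and3P[lti ltj _].
rewrite [X in rcons visited X]/= -/li -/lj.
pose i := Ordinal lti; pose j := Ordinal ltj.
pose fill := PFor 2 0 (PISet next_arr [:: lv 2] (lv 0)).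
set b := BNot _.
have bE : beval s1 b = ~~ (0 < rmem s psq_arr [:: val i; val j]).
  by rewrite /= r1.
rewrite -[run _ _]/(if beval s1 b
  then iset (run fill s1) next_arr [:: lv 0] (lv 1) else s1) bE.
case: ifPn => [z|/negPn pos]; last first.
  split=> //; case: h => [[h1 h2]|]; [left|by right].
  split=> // i' j'; rewrite mem_rcons inE => /predU1P[[e1 e2]|]; last exact: h1.
  have -> : i' = i by exact: val_inj.
  by have -> : j' = j by exact: val_inj.
have [l0 l1] : imem (run fill s1) loop_arr [:: 0%N] = i
    /\ imem (run fill s1) loop_arr [:: 1%N] = j.
  by rewrite !(@run_lv _ [:: 0; 1]%N).
have fillE : forall x, (x < n)%N -> imem (run fill s1) next_arr [:: x] = i.
  pose J m s' := imem s' loop_arr [:: 0%N] = i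
    /\ forall x, (x < m)%N -> imem s' next_arr [:: x] = i.
  suff [] : J n (run fill s1) by [].
  have nE1 : imem s1 0%N [::] = n by rewrite lowE.
  rewrite -[X in J X]nE1; apply: (@for_ind R [:: 0%N] _ _ _ J) => //.
    by move=> m s2 s3 [_ iE lE] [e1 e2]; rewrite /J -lE // -iE.
  move=> m s2 _ mE _ [e1 e2]; split=> // x; rewrite ltnS => lex.
  rewrite imem_iset /= mE eqseq_cons andbT e1.
  by case: eqP lex => // /eqP xm lex; rewrite e2 // ltn_neqAle xm.
split; first by rewrite -r1; apply/funext => a; apply: (run_rframe (p := fill)).
right; exists i, j; split=> // x.
rewrite imem_iset [map _ _]/= [ieval _ _]/= l0 l1 eqseq_cons andbT.
have -> : (val x == i) = (x == i) by [].
by case: (x == i) => //; apply: fillE (ltn_ord x).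
Qed.

Lemma run_emit s (x y : 'I_n) : sizes s -> (forall l, rmem s out_arr l = 0) ->
  rmem (run emit s) out_arr [:: val x; val y]
  = (val y == imem s next_arr [:: val x])%:R.
Proof.
move=> [nE dE] z.
rewrite (run_summation (xs := [::]) (f := fun=> 1)
    (g := fun t => [:: nth 0 t 0; imem s next_arr [:: nth 0 t 0]]%N))
  //= => [|t s1 _ <- iE rE]; last by rewrite (iE next_arr).
rewrite z add0r nE big_mkcond grid_cons_sum (bigD1 x) //=.
rewrite [X in _ + X]big1 ?addr0 => [|k kx]; last first.
  by rewrite big_seq1 eqseq_cons [_ == _]val_eqE (negPf kx).
by rewrite big_seq1 /= !eqseq_cons eqxx andbT eq_sym; case: eqP.
Qed.

End Stages.

(** * The algorithm is correct *)

Definition algorithm : prog :=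
  PSeq squares (PSeq products (PSeq product_squares (PSeq edges
    (PSeq longer_walks (PSeq best_closed_walk (PSeq follow
      (PSeq zero_edges emit))))))).

Definition sqnorm (R : realType) d (x : 'cV[R]_d) : R := \sum_i x i 0 ^+ 2.

Lemma sqnorm_gt0 (R : realType) d (x : 'cV[R]_d) : x != 0 -> 0 < sqnorm x.
Proof.
case/matrix0Pn=> i [j]; rewrite [j]ord1 => nz.
rewrite /sqnorm (bigD1 i) //= ltr_wpDr //; last by rewrite exprn_even_gt0.
by apply: sumr_ge0 => k _; rewrite sqr_ge0.
Qed.

Lemma sum_sqr_mul (R : comPzRingType) m n (f : 'I_m -> R) (g : 'I_n -> R)
    (c : R) :
  \sum_a \sum_b (f a * c * g b) ^+ 2
  = (\sum_a f a ^+ 2) * c ^+ 2 * \sum_b g b ^+ 2.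
Proof.
rewrite !mulr_suml; apply: eq_bigr => a _; rewrite mulr_sumr.
by apply: eq_bigr => b _; rewrite !exprMn.
Qed.

Lemma dotpE (R : realType) n d (u v : 'I_n -> 'cV[R]_d) i j :
  dotp u v i j = \sum_k u i k 0 * v j k 0.
Proof. by rewrite /dotp mxE; apply: eq_bigr => k _; rewrite mxE. Qed.

(** Unless some [u_i^T v_j] vanishes, the table of walks is the one for the
    computable weights and [cycle_minimizer] applies.  Otherwise the walks carry
    meaningless weights, but the result is overwritten. *)
Lemma run_algorithm (R : realType) (n d : nat) (u v : 'I_n -> 'cV[R]_d) :
  (0 < n)%N -> (forall i, u i != 0) -> (forall i, v i != 0) ->
  minimizer u v (output n (run algorithm (input (fun i => u i *m (v i)^T)))).
Proof.
move=> n0 u0 v0; set s0 := input _.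
have sz0 : sizes n d s0 by [].
have A0 (i : 'I_n) (j k : 'I_d) :
    rmem s0 in_arr [:: val i; val j; val k] = u i j 0 * v i k 0.
  by rewrite /= !valK mxE big_ord1 !mxE.
pose U i := sqnorm (u i); pose V i := sqnorm (v i).
have U0 i : 0 < U i by exact: sqnorm_gt0.
have V0 i : 0 < V i by exact: sqnorm_gt0.
set s1 := run squares s0.
have sz1 : sizes n d s1 by exact: (@run_sizes _ _ _ [::]).
have F1 (i : 'I_n) : rmem s1 sq_arr [:: val i] = U i * V i.
  rewrite (run_squares _ sz0) //.
  under eq_bigr do under eq_bigr do rewrite A0 -[X in X * _]mulr1.
  by rewrite sum_sqr_mul expr1n mulr1.
set s2 := run products s1.
have sz2 : sizes n d s2 by exact: (@run_sizes _ _ _ [::]).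
have T2 (i j : 'I_n) (a b : 'I_d) :
    rmem s2 prod_arr [:: val i; val j; val a; val b]
    = u j a 0 * dotp u v i j * v i b 0.
  rewrite (run_products _ _ _ _ sz1) => [|l]; last by rewrite run_rframe.
  rewrite dotpE mulr_sumr mulr_suml; apply: eq_bigr => k _.
  by rewrite run_rframe // !A0; ring.
set s3 := run product_squares s2.
have sz3 : sizes n d s3 by exact: (@run_sizes _ _ _ [::]).
have G3 (i j : 'I_n) :
    rmem s3 psq_arr [:: val i; val j] = U j * dotp u v i j ^+ 2 * V i.
  rewrite (run_product_squares _ _ sz2) => [|l]; last by rewrite !run_rframe.
  under eq_bigr do under eq_bigr do rewrite T2.
  exact: sum_sqr_mul.
have G_gt0 i j : (0 < rmem s3 psq_arr [:: val i; val j]) = (dotp u v i j != 0).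
  by rewrite G3 pmulr_lgt0 // pmulr_rgt0 // exprn_even_gt0.
pose w (i j : 'I_n) : R := edge_weight s3 i j.
have wE i j : dotp u v i j != 0 ->
    w i j = 2 * ln `|dotp u v i j| + (ln (U j) - ln (U i)).
  move=> nz; rewrite /w /edge_weight -[nat_of_ord i]/(val i) G3.
  rewrite /s3 run_rframe // /s2 run_rframe // F1 -real_normK ?num_real //.
  have ab : 0 < `|dotp u v i j| by rewrite normr_gt0.
  have a2 : ln (`|dotp u v i j| ^+ 2) = 2 * ln `|dotp u v i j|.
    by rewrite lnXn // mulr_natl.
  have := exprn_gt0 2 ab; rewrite -a2; move: (_ ^+ 2) => q q0.
  by rewrite !lnM ?posrE ?mulr_gt0 //; ring.
set s4 := run edges s3.
have sz4 : sizes n d s4 by exact: (@run_sizes _ _ _ [::]).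
have E4 k (x y : 'I_n) :
    rmem s4 walk_arr [:: k; val x; val y] = if k is 0 then w x y else 0.
  by rewrite (run_edges _ _ _ sz3) => // l; rewrite !run_rframe.
set s5 := run longer_walks s4.
have sz5 : sizes n d s5 by exact: (@run_sizes _ _ _ [::]).
have walks5 : walks_upto w n s5.
  apply: run_longer_walks sz4 _ _ _ _ => //.
  - by move=> i j; rewrite /edge_weight !(run_rframe (p := edges)).
  - rewrite /s4 run_rframe // /s3 run_rframe // /s2 run_rframe //.
    by rewrite /s1 run_rframe.
  - by move=> l; rewrite !run_iframe.
set s6 := run best_closed_walk s5.
have sz6 : sizes n d s6 by exact: (@run_sizes _ _ _ [::]).
have [k [r [lenE rootE ltk best strict]]] : exists k (x : 'I_n),
    [/\ imem s6 len_var [::] = k, imem s6 root_var [::] = x, (k < n)%N,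
        forall j y, (j < n)%N -> mean_walk w k x <= mean_walk w j y
      & forall j y, (j < k)%N -> mean_walk w k x < mean_walk w j y].
  apply: (run_best_closed_walk n0 sz5 walks5).
    by rewrite !run_iframe.
  by rewrite !run_iframe.
(* The memory holds naturals; the default [x] is never used below [k]. *)
pose pr j (x y : 'I_n) : 'I_n :=
  insubd x (imem s6 pred_arr [:: j; val x; val y]).
have prP j x y : (j < k)%N ->
    imem s6 pred_arr [:: j.+1; val x; val y] = pr j.+1 x y
    /\ minw w j x (pr j.+1 x y) + w (pr j.+1 x y) y = minw w j.+1 x y.
  move=> ltj; have [_ _ h] := walks5.
  have [z zE zm] := h j x y (ltn_trans ltj ltk).
  have -> : pr j.+1 x y = z.
    rewrite /pr /s6 run_iframe // zE.
    by apply: val_inj; rewrite val_insubd ltn_ord.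
  by rewrite /s6 run_iframe.
set c := r :: trace pr k r r.
have cE : cweight w c = minw w k r r.
  by apply: bwalk_trace => j x ltj; case: (prP j r x ltj).
have Uc : uniq c by apply: trace_uniq cE strict.
have rc : r \in c by rewrite inE eqxx.
have szc : size c = k.+1 by rewrite /= size_trace.
set s7 := run follow s6.
have next7 x : imem s7 next_arr [:: val x] = cycle_map c r x.
  apply: (run_follow sz6 lenE rootE ltk _ Uc) => j y ltj.
  by case: (prP j r y ltj).
have sz7 : sizes n d s7 by exact: (@run_sizes _ _ _ [::]).
set s8 := run zero_edges s7.
have sz8 : sizes n d s8 by exact: (@run_sizes _ _ _ [::]).
have outE (f : 'I_n -> 'I_n) :
    (forall x : 'I_n, imem s8 next_arr [:: val x] = f x) ->
    output n (run algorithm s0) = deterministic_mx R f.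
  move=> fE; apply/matrixP => i j.
  rewrite !mxE -[run algorithm s0]/(run emit s8).
  by rewrite (run_emit _ _ sz8) ?fE // => l; rewrite !run_rframe.
have G7 i j :
    rmem s7 psq_arr [:: val i; val j] = rmem s3 psq_arr [:: val i; val j].
  rewrite /s7 run_rframe // /s6 run_rframe // /s5 run_rframe //.
  by rewrite /s4 run_rframe.
have [[pos nextE]|[i [j [neg nextE]]]] := run_zero_edges sz7.
  have nz i j : dotp u v i j != 0 by rewrite -G_gt0 -G7.
  rewrite (outE (cycle_map c r)) => [|x]; last by rewrite nextE next7.
  apply: (cycle_minimizer nz (w := w) (h := fun i => ln (U i))) => //.
    by move=> i j; apply: wE.
  rewrite cE szc; apply: minw_ge => j y; rewrite card_ord => ltj.
  by rewrite mulrC -ler_pdivlMr ?ltr0n //; apply: best.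
rewrite (outE _ nextE); apply: two_cycle_minimizer.
by apply/eqP; rewrite -[_ == _]negbK -G_gt0 -G7.
Qed.

Theorem theorem5p3 :
  exists (P : cmd) (c k : nat),
    forall (R : realType) (n d : nat) (u v : 'I_n -> 'cV[R]_d),
      (0 < n)%N ->
      (forall i : 'I_n, \rank (u i *m (v i)^T) = 1%N) ->
      exists (t : nat) (s : state R),
        [/\ exec P (input (fun i : 'I_n => u i *m (v i)^T)) t s,
            (t <= c * (n * d ^ 2) ^ k)%N
          & minimizer u v (output n s)].
Proof.
have [c [k cost]] := pcost_poly algorithm.
exists (compile algorithm), (c * 2 ^ k)%N, k => R n d u v n0 rank1.
have nz i : (u i != 0) && (v i != 0).
  rewrite -negb_or; apply/negP => /orP[] /eqP z; have := rank1 i.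
    by rewrite z mul0mx mxrank0.
  by rewrite z trmx0 mulmx0 mxrank0.
have d0 : (0 < d)%N.
  have := rank_leq_row (u (Ordinal n0) *m (v (Ordinal n0))^T).
  by rewrite rank1.
set N := (n * d ^ 2)%N.
have nN : (n <= N)%N by rewrite leq_pmulr // expn_gt0 d0.
have dN : (d <= N)%N.
  by rewrite (leq_trans (leq_pmulr d d0)) // mulnn leq_pmull.
have [||t [ex lt]] := @exec_compile R N [::] algorithm
  (input (fun i => u i *m (v i)^T)) isT; try by [].
exists t, (run algorithm (input (fun i => u i *m (v i)^T))); split=> //.
  apply: leq_trans lt (leq_trans (cost N) _).
  have N0 : (0 < N)%N by apply: leq_trans nN.
  rewrite -mulnA leq_mul2l -expnMn; apply/orP; right.
  case: (k) => // k'; rewrite leq_exp2r // mul2n -addnn -addn1 leq_add2l //.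
by apply: run_algorithm => // i; case/andP: (nz i).
Qed.
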